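(* Let $\mu,L,M>0$ and let $f:\mathbb{R}^n\to\mathbb{R}$ be three times continuously differentiable, $\mu$-strongly convex, with $L$-Lipschitz continuous gradient, and $M$-self-concordant. Let $\varkappa=L/\mu$, let $\mathbf{x}_*$ be the unique minimizer of $f$, let $\mathbf{x}_0\in\mathbb{R}^n$, let $\mathbf{B}_0\in\mathbb{R}^{n\times n}$ be symmetric positive definite, and let $(\mathbf{x}_k)_{k\ge0}$ be generated by the smoothness aided adaptive BFGS algorithm with parameters $M,L$ (with $\nabla f(\mathbf{x}_k)\ne\mathbf{0}$ for all $k$). Put $\Delta=f(\mathbf{x}_0)-f(\mathbf{x}_* )$, $\bar{\mathbf{B}}_0=\mathbf{B}_0/L$ and $\Gamma=(1+\sqrt2\,M\sqrt{\Delta})^2$. Then for all integers $k\ge1$, $$\frac{f(\mathbf{x}_k)-f(\mathbf{x}_* )}{f(\mathbf{x}_0)-f(\mathbf{x}_* )}\le\left(1-\frac1\varkappa\exp\left(-\frac{(\Psi(\bar{\mathbf{B}}_0)+1)(2\ln\min\{\Gamma,\varkappa\}+1)+\varkappa\min\{\Gamma,\varkappa\}\bigl((\ln\Gamma)^2+24\bigr)}{k}\right)\right)^{k}.$$ Furthermore, for all integers $k\ge 2(\Psi(\bar{\mathbf{B}}_0)+1)(2\ln\min\{\Gamma,\varkappa\}+1)+2\varkappa\min\{\Gamma,\varkappa\}\bigl((\ln\Gamma)^2+24\bigr)$, $$\frac{f(\mathbf{x}_k)-f(\mathbf{x}_* )}{f(\mathbf{x}_0)-f(\mathbf{x}_*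 )}\le\left(1-\frac{1}{2\varkappa}\right)^{k}.$$
   Context: $\|\cdot\|$ is the Euclidean norm for vectors, and $\|\mathbf{d}\|_{\mathbf{x}}=(\mathbf{d}^\top\nabla^2 f(\mathbf{x})\mathbf{d})^{1/2}$. The function $f$ is $\mu$-strongly convex if $f(\lambda\mathbf{x}+(1-\lambda)\mathbf{y})\le\lambda f(\mathbf{x})+(1-\lambda)f(\mathbf{y})-\frac{\lambda(1-\lambda)\mu}{2}\|\mathbf{x}-\mathbf{y}\|^2$ for all $\mathbf{x},\mathbf{y}\in\mathbb{R}^n$, $\lambda\in[0,1]$. It has $L$-Lipschitz gradient if $\|\nabla f(\mathbf{x})-\nabla f(\mathbf{y})\|\le L\|\mathbf{x}-\mathbf{y}\|$ for all $\mathbf{x},\mathbf{y}$. A convex $f$ is $M$-self-concordant if $|\nabla^3 f(\mathbf{x})[\mathbf{d},\mathbf{d},\mathbf{d}]|\le 2M\|\mathbf{d}\|_{\mathbf{x}}^3$ for all $\mathbf{x},\mathbf{d}$. For a symmetric positive definite $n\times n$ matrix $\mathbf{A}$, $\Psi(\mathbf{A})=\mathrm{Tr}(\mathbf{A})-\ln\det(\mathbf{A})-n$. Smoothness aided adaptive BFGS algorithm: for $k=0,1,2,\dots$ set $\mathbf{g}_k=\nabla f(\mathbf{x}_k)$, $\mathbf{d}_k=-\mathbf{B}_k^{-1}\mathbf{g}_k$, $\eta_k=-\mathbf{g}_k^\top\mathbf{d}_k/\|\mathbf{d}_k\|_{\mathbf{x}_k}$, $\alpha_k=\|\mathbf{d}_k\|_{\mathbf{x}_k}/(\sqrt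 L\,\|\mathbf{d}_k\|)$, $$\tilde t_k=\begin{cases}\dfrac{\eta_k}{(1+M\eta_k)\|\mathbf{d}_k\|_{\mathbf{x}_k}},&(1+M\eta_k)\alpha_k\le1,\\[2mm]\dfrac{M\eta_k\alpha_k^2+(1-\alpha_k)^2}{M\|\mathbf{d}_k\|_{\mathbf{x}_k}},&(1+M\eta_k)\alpha_k>1,\end{cases}$$ $\mathbf{x}_{k+1}=\mathbf{x}_k+\tilde t_k\mathbf{d}_k$, $\mathbf{s}_k=\mathbf{x}_{k+1}-\mathbf{x}_k$, $\mathbf{y}_k=\nabla f(\mathbf{x}_{k+1})-\nabla f(\mathbf{x}_k)$, and $$\mathbf{B}_{k+1}=\mathbf{B}_k-\frac{\mathbf{B}_k\mathbf{s}_k\mathbf{s}_k^\top\mathbf{B}_k}{\mathbf{s}_k^\top\mathbf{B}_k\mathbf{s}_k}+\frac{\mathbf{y}_k\mathbf{y}_k^\top}{\mathbf{y}_k^\top\mathbf{s}_k}.$$ *)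

(* Defs.v *)
From HB Require Import structures.
From mathcomp Require Import all_boot all_order all_algebra.
From mathcomp Require Import all_classical all_reals all_analysis.

Set Implicit Arguments.
Unset Strict Implicit.
Unset Printing Implicit Defensive.

Import Order.TTheory GRing.Theory Num.Theory.
Import numFieldNormedType.Exports.

Local Open Scope classical_set_scope.
Local Open Scope ring_scope.

Section Definitions.
Context {R : realType} {n : nat}.
Implicit Types (f : 'cV[R]_n -> R) (x y d s u v w : 'cV[R]_n) (A B : 'M[R]_n).

Definition dotv u v : R := (u^T *m v) 0 0.

(* The library norm `|x| on matrices is the sup norm, which induces the same
   topology and derivatives but is not the Euclidean norm. *)
Definition enorm x : R := Num.sqrt (dotv x x).

Definition basis_vec (i : 'I_n) : 'cV[R]_n := delta_mx i 0.

Definition grad f x : 'cV[R]_n := \col_i 'D_(basis_vec i) f x.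

Definition hess f x : 'M[R]_n :=
  \matrix_(i, j) 'D_(basis_vec i) ('D_(basis_vec j) f) x.

(* nabla^3 f(x)[u, v, w] as an iterated directional derivative; for C^3
   functions it is the contraction of the tensor of third partials. *)
Definition deriv3 f x u v w : R := 'D_u ('D_v ('D_w f)) x.

Definition local_norm f x d : R := Num.sqrt (dotv d (hess f x *m d)).

(* Quantifying over all directions v is equivalent to quantifying over the
   coordinate directions, by linearity of the differential in v. *)
Fixpoint cont_diff (k : nat) f : Prop :=
  if k is k'.+1 then
    (forall x, differentiable f x) /\ (forall v, cont_diff k' ('D_v f))
  else continuous f.

Definition strongly_convex (mu : R) f : Prop :=
  forall x y (lam : R), 0 <= lam <= 1 ->
    f (lam *: x + (1 - lam) *: y) <=
      lam * f x + (1 - lam) * f y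
      - lam * (1 - lam) * mu / 2 * enorm (x - y) ^+ 2.

Definition lipschitz_grad (L : R) f : Prop :=
  forall x y, enorm (grad f x - grad f y) <= L * enorm (x - y).

Definition self_concordant (M : R) f : Prop :=
  convex_function ([set: 'cV[R]_n] : set (convex_lmodType 'cV[R]_n)) f /\
  forall x d, `|deriv3 f x d d d| <= 2 * M * local_norm f x d ^+ 3.

(* A minimizer of a strongly convex function is automatically unique. *)
Definition is_minimizer f x : Prop := forall y, f x <= f y.

Definition sym_posdef A : Prop :=
  A^T = A /\ forall v, v != 0 -> 0 < dotv v (A *m v).

Definition Psi A : R := \tr A - ln (\det A) - n%:R.

Definition bfgs_direction f x B : 'cV[R]_n := - (invmx B *m grad f x).

Definition adaptive_step (M L : R) f x d : R :=
  let nd := local_norm f x d in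
  let eta := - dotv (grad f x) d / nd in
  let alpha := nd / (Num.sqrt L * enorm d) in
  if (1 + M * eta) * alpha <= 1
  then eta / ((1 + M * eta) * nd)
  else (M * eta * alpha ^+ 2 + (1 - alpha) ^+ 2) / (M * nd).

Definition bfgs_update B s y : 'M[R]_n :=
  B - (dotv s (B *m s))^-1 *: (B *m s *m s^T *m B)
    + (dotv y s)^-1 *: (y *m y^T).

Definition adaptive_bfgs (M L : R) f (x0 : 'cV[R]_n) (B0 : 'M[R]_n)
    (x : nat -> 'cV[R]_n) (B : nat -> 'M[R]_n) : Prop :=
  [/\ x 0%N = x0, B 0%N = B0 &
    forall k : nat,
      let d := bfgs_direction f (x k) (B k) in
      x k.+1 = x k + adaptive_step M L f (x k) d *: d /\
      B k.+1 = bfgs_update (B k) (x k.+1 - x k)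
                 (grad f (x k.+1) - grad f (x k))].

End Definitions.

(* Main.v *)
Require Import Defs.
From HB Require Import structures.
From mathcomp Require Import all_boot all_order all_algebra.
From mathcomp Require Import all_classical all_reals all_analysis.
From mathcomp Require Import ring lra.

Set Implicit Arguments.
Unset Strict Implicit.
Unset Printing Implicit Defensive.

Import Order.TTheory GRing.Theory Num.Theory.
Import numFieldNormedType.Exports.

Local Open Scope classical_set_scope.
Local Open Scope ring_scope.

(* Let phi(t) = f(x + t d) along a search direction d. Self-concordance makes
   phi''^(-1/2) M-Lipschitz, which together with the L-Lipschitz gradient bounds
   phi' above by the antiderivative of min(|d|_x^2/(1 - M|d|_x t)^2, L|d|^2);
   the adaptive step is the zero of this majorant. As the majorant is convex, a
   step s decreases f by at least -g.s/2. Strong convexity and the lower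
   self-concordance bound give y.s >= -g.s / m_k, where m_k is the minimum of
   kappa and (1 + sqrt 2 M sqrt(f(x_k) - min f))^2.
   With a_k = mu (-g_k.s_k)/|g_k|^2, gradient dominance gives
   f(x_{k+1}) - min f <= (1 - a_k)(f(x_k) - min f), while the exact change of
   Psi under the BFGS update and cocoercivity of the gradient give
   ln (kappa a_k) >= Psi(B_{k+1}/L) - Psi(B_k/L) - ln m_k.
   Summing and applying AM-GM twice, the rate after k steps is governed by
   Psi(B_0/L) + sum_(j < k) ln m_j. Since m_j <= m, this first yields linear
   convergence with factor 1 - 4/(7 kappa m) once k >= 2 Psi(B_0/L) + 1; fed
   back into m_j, it bounds the tail of the sum independently of k by comparison
   with the integral of ln(1 + u)/u. *)

(** * Positive definite matrices *)

Section EuclideanSpace.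
Context {R : realType} {n : nat}.
Implicit Types (u v w : 'cV[R]_n) (A : 'M[R]_n) (c : R).

Lemma dotvE u v : dotv u v = \sum_i u i 0 * v i 0.
Proof. by rewrite /dotv mxE; apply: eq_bigr => i _; rewrite mxE. Qed.

Lemma dotvC u v : dotv u v = dotv v u.
Proof. by rewrite !dotvE; apply: eq_bigr => i _; rewrite mulrC. Qed.

Lemma dotvDr u v w : dotv u (v + w) = dotv u v + dotv u w.
Proof. by rewrite /dotv mulmxDr mxE. Qed.

Lemma dotvZr c u v : dotv u (c *: v) = c * dotv u v.
Proof. by rewrite /dotv -scalemxAr mxE. Qed.

Lemma dotvNr u v : dotv u (- v) = - dotv u v.
Proof. by rewrite /dotv mulmxN mxE. Qed.

Lemma dotvBr u v w : dotv u (v - w) = dotv u v - dotv u w.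
Proof. by rewrite dotvDr dotvNr. Qed.

Lemma dotvDl u v w : dotv (u + v) w = dotv u w + dotv v w.
Proof. by rewrite dotvC dotvDr !(dotvC w). Qed.

Lemma dotvZl c u v : dotv (c *: u) v = c * dotv u v.
Proof. by rewrite dotvC dotvZr dotvC. Qed.

Lemma dotvNl u v : dotv (- u) v = - dotv u v.
Proof. by rewrite dotvC dotvNr dotvC. Qed.

Lemma dotvBl u v w : dotv (u - v) w = dotv u w - dotv v w.
Proof. by rewrite dotvDl dotvNl. Qed.

Definition dotv_lin :=
  (dotvDl, dotvDr, dotvZl, dotvZr, dotvNl, dotvNr, dotvBl, dotvBr).

Lemma dotv0l u : dotv 0 u = 0.
Proof. by rewrite -(scale0r 0) dotvZl mul0r. Qed.

Lemma dotvv_ge0 u : 0 <= dotv u u.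
Proof. by rewrite dotvE; apply: sumr_ge0 => i _; rewrite -expr2 sqr_ge0. Qed.

Lemma dotvv_eq0 u : (dotv u u == 0) = (u == 0).
Proof.
apply/idP/eqP => [|->]; last by rewrite dotv0l.
rewrite dotvE psumr_eq0 => [/allP u0|i _]; last by rewrite -expr2 sqr_ge0.
apply/colP => i; rewrite mxE; apply/eqP.
by have := u0 i (mem_index_enum i); rewrite -expr2 sqrf_eq0.
Qed.

Lemma dotvv_gt0 u : u != 0 -> 0 < dotv u u.
Proof. by move=> u0; rewrite lt_neqAle dotvv_ge0 eq_sym dotvv_eq0 u0. Qed.

Lemma enorm_sqr u : enorm u ^+ 2 = dotv u u.
Proof. by rewrite sqr_sqrtr// dotvv_ge0. Qed.

Lemma dotv_CauchySchwarz u v : dotv u v <= enorm u * enorm v.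
Proof.
have [->|v0] := eqVneq v 0.
  by rewrite dotvC dotv0l mulr_ge0// sqrtr_ge0.
have vv := dotvv_gt0 v0.
have [uv|/ltW uv] := leP (dotv u v) 0.
  by apply: (le_trans uv); rewrite mulr_ge0// sqrtr_ge0.
rewrite -(@ler_pXn2r _ 2)// ?nnegrE// ?mulr_ge0 ?sqrtr_ge0//.
rewrite exprMn !enorm_sqr.
have := dotvv_ge0 (u - (dotv u v / dotv v v) *: v).
rewrite !dotv_lin (dotvC v u) => h.
rewrite -subr_ge0.
suff : 0 <= (dotv u u * dotv v v - dotv u v ^+ 2) / dotv v v.
  by rewrite pmulr_lge0// invr_gt0.
apply: le_trans h _; rewrite le_eqVlt; apply/orP; left; apply/eqP.
by field; rewrite gt_eqF.
Qed.

Lemma mulmx_outer u v w : (u *m v^T) *m w = dotv v w *: u.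
Proof.
by rewrite -mulmxA [v^T *m w]mx11_scalar mul_mx_scalar.
Qed.

Lemma mxtrace_outer u v : \tr (u *m v^T) = dotv u v.
Proof.
rewrite /mxtrace dotvE; apply: eq_bigr => i _.
by rewrite !mxE big_ord1 !mxE.
Qed.

End EuclideanSpace.

(** The block matrix with rows (1, -v^T) and (u, I) has two block-triangular factorisations, one
    with determinant det(I + u v^T), the other with 1 + v^T u. *)
Lemma det_add1_outer (R : realType) n (u v : 'cV[R]_n) :
  \det (1%:M + u *m v^T) = 1 + dotv v u.
Proof.
have e1 : block_mx (1%:M : 'M[R]_1) 0 u 1%:M *m
     block_mx 1%:M (- v^T) 0 (1%:M + u *m v^T)
   = block_mx 1%:M (- v^T) u 1%:M.
  rewrite mulmx_block !mul1mx !mul0mx !mulmx1 !addr0 mulmxN.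
  by rewrite addrCA addNr addr0.
have e2 : block_mx (1%:M + v^T *m u) (- v^T) 0 1%:M *m
     block_mx (1%:M : 'M[R]_1) 0 u 1%:M
   = block_mx 1%:M (- v^T) u 1%:M.
  rewrite mulmx_block !mul0mx ?mul1mx !mulmx1 ?mulmx0 !add0r mulNmx.
  by rewrite addrK.
have := congr1 determinant (etrans e1 (esym e2)).
rewrite !det_mulmx det_lblock !det_ublock !det1 !mulr1 !mul1r => ->.
by rewrite det_mx11 !mxE eqxx /dotv mxE.
Qed.

(** Block elimination of the first coordinate gives the determinant. The Schur complement subtracts
    a positive semidefinite rank-one matrix from the lower block, so its trace is at most that of
    the block. *)
Lemma sym_posdef_schur (R : realType) n (A : 'M[R]_(1 + n)) (a := A 0 0) :
  sym_posdef A ->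
  let S := drsubmx A - a^-1 *: (dlsubmx A *m ursubmx A) in
  [/\ 0 < a, sym_posdef S, \det A = a * \det S & \tr S <= \tr A - a].
Proof.
move=> [A_sym A_pos] S.
have urE : ursubmx A = (dlsubmx A)^T.
  by rewrite trmx_dlsub A_sym.
have ulE : ulsubmx A = a%:M.
  rewrite [ulsubmx A]mx11_scalar !mxE; congr (_%:M).
  by congr (A _ _); apply/val_inj.
have block v (u : 'cV_1) : A *m col_mx u v =
    col_mx (a *: u + ursubmx A *m v) (dlsubmx A *m u + drsubmx A *m v).
  by rewrite -[X in X *m _]submxK mul_block_col ulE mul_scalar_mx.
have a_gt0 : 0 < a.
  have := A_pos (delta_mx 0 0).
  rewrite /dotv trmx_delta -rowE -colE !mxE => -> //.
  apply/eqP => /matrixP/(_ 0 0)/eqP.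
  by rewrite !mxE !eqxx/= oner_eq0.
have a0 : a != 0 by rewrite gt_eqF.
split=> //.
- split=> [|v v0].
    by rewrite /S linearB linearZ/= trmx_mul urE trmxK trmx_drsub A_sym.
  (* This [u] makes the first block of the product of [A] with (u, v) vanish, so the form of [S] at
     [v] is the form of [A] at (u, v). *)
  set u := - a^-1 *: (ursubmx A *m v).
  have -> : dotv v (S *m v) = dotv (col_mx u v) (A *m col_mx u v).
    rewrite block /u scalerA mulrN mulfV// scaleN1r addNr.
    rewrite /dotv tr_col_mx mul_row_col mulmx0 add0r.
    rewrite /S mulmxBl -scalemxAl -scalemxAr scaleNr addrC.
    by rewrite mulmxA.
  apply: A_pos; apply: contra_neq v0 => /(congr1 dsubmx).
  by rewrite col_mxKd linear0.
- have -> : A = block_mx 1%:M 0 (a^-1 *: dlsubmx A) 1%:M *m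
                block_mx a%:M (ursubmx A) 0 S.
    rewrite mulmx_block !mul1mx !mul0mx !addr0.
    rewrite mul_mx_scalar scalerA mulfV// scale1r -scalemxAl /S addrC subrK.
    by rewrite -ulE submxK.
  rewrite det_mulmx det_lblock det_ublock !det1 !mul1r det_mx11 mxE.
  by rewrite eqxx mulr1n.
- rewrite -[X in _ <= \tr X - _]submxK mxtrace_block ulE mxtrace_scalar.
  rewrite mulr1n [a + _]addrC addrK /S linearB linearZ/= urE mxtrace_outer.
  by rewrite gerBl mulr_ge0// ?dotvv_ge0// ltW// invr_gt0.
Qed.

(* As for Hadamard's inequality, by induction on Schur complements. *)
Lemma sym_posdef_Psi (R : realType) n (A : 'M[R]_n) :
  sym_posdef A -> 0 < \det A /\ 0 <= Psi A.
Proof.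
elim: n A => [|n IH] A A_pd.
  by rewrite /Psi det_mx00 ln1 /mxtrace big_ord0 subrr subr0.
have [a0 /IH[S0 PS] detE trS] := @sym_posdef_schur R n A A_pd.
rewrite /Psi detE mulr_gt0//; split=> //.
rewrite lnM ?posrE//.
(* The eliminated pivot contributes a - 1 - ln a >= 0 to [Psi]. *)
have := @le_ln1Dx _ (A 0 0 - 1); rewrite addrCA subrr addr0.
move: PS trS; rewrite /Psi -natr1.
set S := (X in \det X).
set t := \tr S; set T := \tr A; set l := ln _; set l' := ln (A 0 0).
move=> PS trS lna.
have {}lna : l' <= A 0 0 - 1 by apply: lna; lra.
by move: PS trS lna; rewrite -/l; lra.
Qed.

(** * The BFGS update *)

Lemma mulmx_quad (R : realType) n (A W : 'M[R]_n) v :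
  dotv v ((W *m A *m W^T) *m v) = dotv (W^T *m v) (A *m (W^T *m v)).
Proof. by rewrite /dotv trmx_mul trmxK !mulmxA. Qed.

(* With [c^2 = y.s / s.Bs], the update factors as [W B W^T] for the rank-one
   perturbation [W = 1 + (c / y.s) (y - c B s) s^T] of the identity, whose
   determinant is [c]. *)
Lemma bfgs_update_posdef (R : realType) n (B : 'M[R]_n) s y :
  sym_posdef B -> 0 < dotv y s ->
  [/\ sym_posdef (bfgs_update B s y),
      \det (bfgs_update B s y) = dotv y s / dotv s (B *m s) * \det B &
      \tr (bfgs_update B s y) =
        \tr B - dotv (B *m s) (B *m s) / dotv s (B *m s)
        + dotv y y / dotv y s].
Proof.
move=> [B_sym B_pos] ys_gt0; set b := B *m s.
have s0 : s != 0.
  by apply: contraTneq ys_gt0 => ->; rewrite dotvC dotv0l ltxx.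
have sBs_gt0 : 0 < dotv s b by exact: B_pos.
have bT : s^T *m B = b^T by rewrite trmx_mul B_sym.
have updE : bfgs_update B s y =
    B - (dotv s b)^-1 *: (b *m b^T) + (dotv y s)^-1 *: (y *m y^T).
  by rewrite /bfgs_update -bT /b !mulmxA.
set c := Num.sqrt (dotv y s / dotv s b).
have c_gt0 : 0 < c by rewrite sqrtr_gt0 divr_gt0.
have c2 : c ^+ 2 = dotv y s / dotv s b by rewrite sqr_sqrtr// divr_ge0// ltW.
set W := 1%:M + ((c / dotv y s) *: (y - c *: b)) *m s^T.
have detW : \det W = c.
  rewrite /W det_add1_outer !dotv_lin (dotvC s y).
  transitivity (1 + c - c ^+ 2 / dotv y s * dotv s b).
    by field; rewrite gt_eqF.
  by rewrite c2; field; rewrite !gt_eqF.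
have WBW : bfgs_update B s y = W *m B *m W^T.
  rewrite updE /W; set e := y - c *: b; set k := c / dotv y s.
  have -> : (1%:M + (k *: e) *m s^T) *m B = B + k *: (e *m b^T).
    by rewrite mulmxDl mul1mx -mulmxA bT scalemxAl.
  rewrite [(_ + _)^T]linearD/= trmx1 (trmx_mul _ s^T) trmxK mulmxDr mulmx1.
  have -> : (B + k *: (e *m b^T)) *m (s *m (k *: e)^T) =
            k *: (b *m e^T) + (k ^+ 2 * dotv s b) *: (e *m e^T).
    rewrite [(k *: e)^T]linearZ/= mulmxA mulmxDl -/b -scalemxAl mulmx_outer.
    rewrite (dotvC b s) scalerA.
    by rewrite mulmxDl -!scalemxAr -!scalemxAl scalerA mulrA -expr2.
  have kk : k ^+ 2 * dotv s b = (dotv y s)^-1.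
    by rewrite exprMn c2; field; rewrite !gt_eqF.
  have sb : (dotv s b)^-1 = c ^+ 2 / dotv y s.
    by rewrite c2; field; rewrite !gt_eqF.
  rewrite kk sb; apply/matrixP => i j.
  rewrite !mxE !big_ord1 !mxE /k; field.
  by rewrite gt_eqF.
split.
- split=> [|v v0].
    by rewrite WBW !trmx_mul trmxK B_sym mulmxA.
  rewrite WBW mulmx_quad; apply: B_pos.
  apply: contra_neq v0 => Wv0.
  have Wu : W^T \in unitmx.
    by rewrite unitmxE unitfE det_tr detW gt_eqF.
  by rewrite -(mulKmx Wu v) Wv0 mulmx0.
- by rewrite WBW !det_mulmx det_tr detW mulrC mulrA -expr2 c2.
- rewrite updE !mxtraceD raddfN/= !mxtraceZ !mxtrace_outer.
  by congr (_ - _ + _); rewrite mulrC.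
Qed.

(** The power of [c] in the determinant is the same before and after the update; hence [c] scales
    the trace terms but is absent from the logarithm of the determinant ratio. *)
Lemma Psi_bfgs_update (R : realType) n (B : 'M[R]_n) s y c :
  sym_posdef B -> 0 < dotv y s -> 0 < c ->
  Psi (c *: bfgs_update B s y) = Psi (c *: B)
    - c * (dotv (B *m s) (B *m s) / dotv s (B *m s))
    + c * (dotv y y / dotv y s)
    - ln (dotv y s / dotv s (B *m s)).
Proof.
move=> B_pd ys_gt0 c_gt0.
have s0 : s != 0.
  by apply: contraTneq ys_gt0 => ->; rewrite dotvC dotv0l ltxx.
have [_ detE trE] := bfgs_update_posdef B_pd ys_gt0.
have sBs : 0 < dotv s (B *m s) by apply: B_pd.2.
have [detB _] := sym_posdef_Psi B_pd.
rewrite /Psi !mxtraceZ !detZ detE trE mulrCA.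
rewrite [ln (_ / _ * _)]lnM ?posrE ?divr_gt0 ?(mulr_gt0 (exprn_gt0 _ _))//.
set l1 := ln _; set l2 := ln _; set D := dotv y y / _.
by set E := dotv (B *m s) _ / _; ring.
Qed.

Lemma sym_posdefZ (R : realType) n (B : 'M[R]_n) c :
  0 < c -> sym_posdef B -> sym_posdef (c *: B).
Proof.
move=> c0 [Bs Bp]; split=> [|v v0]; first by rewrite linearZ/= Bs.
by rewrite -scalemxAl dotvZr mulr_gt0// Bp.
Qed.

(** * Self-concordant functions of one variable *)

(** The mean value theorem for G - F. It replaces integration throughout: a bound on a derivative is
    integrated by exhibiting an antiderivative. *)
Lemma ler_increment (R : realType) (F F' G G' : R -> R) (a b : R) : a <= b ->
  (forall t, a <= t <= b -> is_derive t 1 F (F' t)) ->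
  (forall t, a <= t <= b -> is_derive t 1 G (G' t)) ->
  (forall t, a <= t <= b -> F' t <= G' t) ->
  F b - F a <= G b - G a.
Proof.
move=> ab dF dG FG.
have dH t : a <= t <= b -> is_derive t 1 (G - F) (G' t - F' t).
  by move=> tab; apply: is_deriveB; [exact: dG|exact: dF].
have [||c cab] := @MVT_segment R (G - F) (fun t => G' t - F' t) a b ab.
- move=> t; rewrite in_itv/= => /andP[/ltW at_ /ltW tb].
  by apply: dH; rewrite at_.
- apply: derivable_within_continuous => t; rewrite in_itv/= => tab.
  by have [] := dH t tab.
- rewrite in_itv/= in cab; rewrite !fctE.
  have : 0 <= (G' c - F' c) * (b - a).
    by rewrite mulr_ge0 ?subr_ge0// FG.
  by move=> h e; rewrite -e in h; lra.
Qed.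

Lemma is_derive_quad (R : realType) (a b t : R) :
  is_derive t (1 : R) (fun s : R => a * s ^+ 2 + b * s) (2 * a * t + b).
Proof.
have h : is_derive t (1 : R) (a *: ((@id R) ^+ 2) + b *: (@id R))
   (a *: ((2%:R * t ^+ 1) *: 1) + b *: 1) by exact: is_deriveD.
apply: is_derive_eq h _. rewrite /GRing.scale/=; ring.
Qed.

Lemma is_derive_inv_affine (R : realType) (k t : R) : 1 + k * t != 0 ->
  is_derive t (1 : R) (fun s : R => (1 + k * s)^-1) (- k / (1 + k * t) ^+ 2).
Proof.
move=> kt.
have h : is_derive t (1 : R) (cst 1 + k *: (@id R)) (0 + k *: 1).
  exact: is_deriveD.
have := @is_deriveV R _ t _ 1 _ h; rewrite add0r => /(_ kt) h2.
apply: is_derive_eq h2 _; rewrite -[(_ + _) t]/(1 + k * t) -[k *: 1]/(k * 1).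
by rewrite /GRing.scale/=; field.
Qed.

Section SelfConcordantLine.
Context {R : realType}.
Variables (M : R) (p p' : R -> R).
Hypothesis M_gt0 : 0 < M.
Hypothesis p_derive : forall t, is_derive t (1 : R) p (p' t).
Hypothesis p_gt0 : forall t, 0 < p t.
Hypothesis p'_le : forall t, `|p' t| <= 2 * M * Num.sqrt (p t) ^+ 3.

Let is_derive_invsqrt t : is_derive t (1 : R) (fun s => (Num.sqrt (p s))^-1)
  (- p' t / (2 * Num.sqrt (p t) ^+ 3)).
Proof.
have st : 0 < Num.sqrt (p t) by rewrite sqrtr_gt0.
have h := is_derive1_comp (is_derive1_sqrt (p_gt0 t)) (p_derive t).
have := @is_deriveV R _ t _ 1 _ h; rewrite /= => /(_ (lt0r_neq0 st)) h2.
apply: is_derive_eq h2 _; rewrite /GRing.scale/=; field.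
by rewrite gt_eqF.
Qed.

Let slope t : `|- p' t / (2 * Num.sqrt (p t) ^+ 3)| <= M.
Proof.
have st : 0 < 2 * Num.sqrt (p t) ^+ 3.
  by rewrite mulr_gt0// exprn_gt0// sqrtr_gt0.
rewrite normrM normrN normfV (gtr0_norm st) ler_pdivrMr//.
by apply: (le_trans (p'_le t)); lra.
Qed.

(** Here [p] is the second derivative along a line. The derivative of p^(-1/2) is -p' / (2 p^(3/2)),
    which self-concordance bounds by [M] in absolute value. *)
Lemma self_concordant_invsqrt t : 0 <= t ->
  (Num.sqrt (p 0))^-1 - M * t <= (Num.sqrt (p t))^-1
    <= (Num.sqrt (p 0))^-1 + M * t.
Proof.
move=> t0.
have dM (c s : R) : is_derive s (1 : R) (fun s => 0 * s ^+ 2 + c * s) c.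
  by have := is_derive_quad 0 c s; rewrite mulr0 mul0r add0r.
have sl s : - M <= - p' s / (2 * Num.sqrt (p s) ^+ 3) <= M.
  by rewrite -ler_norml slope.
have h1 := ler_increment t0 (fun s _ => dM (- M) s)
  (fun s _ => is_derive_invsqrt s) (fun s _ => (andP (sl s)).1).
have h2 := ler_increment t0 (fun s _ => is_derive_invsqrt s) (fun s _ => dM M s)
  (fun s _ => (andP (sl s)).2).
by apply/andP; split; lra.
Qed.

Let nd := Num.sqrt (p 0).
Let nd_gt0 : 0 < nd. Proof. by rewrite sqrtr_gt0. Qed.

(** Inverts the lower bound on p^(-1/2), which is positive exactly while M nd t < 1. *)
Lemma self_concordant_ub t : 0 <= t -> M * nd * t < 1 ->
  p t <= nd ^+ 2 / (1 - M * nd * t) ^+ 2.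
Proof.
move=> t0 Mt; have /andP[h _] := self_concordant_invsqrt t0.
have st : 0 < Num.sqrt (p t) by rewrite sqrtr_gt0.
have u0 : 0 < 1 - M * nd * t by rewrite subr_gt0.
have sle : Num.sqrt (p t) <= nd / (1 - M * nd * t).
  rewrite ler_pdivlMr// -ler_pdivlMl// mulrC -ler_pdivrMr//.
  apply: le_trans h; rewrite -/nd.
  by rewrite le_eqVlt; apply/orP; left; apply/eqP; field; rewrite gt_eqF.
rewrite -expr_div_n -[p t]sqr_sqrtr ?(ltW (p_gt0 t))//.
by rewrite lerXn2r// nnegrE ltW// divr_gt0.
Qed.

Lemma self_concordant_lb t : 0 <= t ->
  nd ^+ 2 / (1 + M * nd * t) ^+ 2 <= p t.
Proof.
move=> t0; have /andP[_ h] := self_concordant_invsqrt t0.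
have st : 0 < Num.sqrt (p t) by rewrite sqrtr_gt0.
have u0 : 0 < 1 + M * nd * t.
  by rewrite ltr_pwDl// !mulr_ge0// ltW.
have sle : nd / (1 + M * nd * t) <= Num.sqrt (p t).
  rewrite ler_pdivrMr//.
  have -> : Num.sqrt (p t) * (1 + M * nd * t) =
    nd * Num.sqrt (p t) * (nd^-1 + M * t) by field; rewrite gt_eqF.
  rewrite -[leLHS](mulfK (lt0r_neq0 st)).
  by rewrite ler_wpM2l// mulr_ge0// ltW.
rewrite -expr_div_n -[p t]sqr_sqrtr ?(ltW (p_gt0 t))//.
by rewrite lerXn2r// nnegrE ltW// divr_gt0.
Qed.

Variable q : R -> R.
Hypothesis q_derive : forall t, is_derive t (1 : R) q (p t).

Let inv_increment (c k t : R) : 1 + k * t != 0 -> k != 0 ->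
  is_derive t (1 : R) (fun s : R => - c / k * (1 + k * s)^-1)
    (c / (1 + k * t) ^+ 2).
Proof.
move=> kt k0; have h : is_derive t (1 : R)
    ((- c / k) *: (fun s : R => (1 + k * s)^-1)) (_ *: _) :=
  is_deriveZ _ (is_derive_inv_affine kt).
by apply: is_derive_eq h _; rewrite /GRing.scale/=; field; rewrite kt.
Qed.

(** Integrates the bound on [p], using that -c / (k (1 + k t)) is an antiderivative of c / (1 + k
    t)^2; here k = -M nd, and k = M nd for the lower bound. *)
Lemma self_concordant_increment_ub t : 0 <= t -> M * nd * t < 1 ->
  q t - q 0 <= nd ^+ 2 * t / (1 - M * nd * t).
Proof.
move=> t0 Mt; set k := - (M * nd).
have k0 : k != 0 by rewrite oppr_eq0 mulf_neq0 ?gt_eqF.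
have dk s : 0 <= s <= t -> 0 < 1 + k * s.
  move=> /andP[s0 st]; rewrite mulNr subr_gt0; apply: le_lt_trans Mt.
  by rewrite ler_wpM2l// mulr_ge0// ltW.
have := ler_increment t0 (fun s _ => q_derive s)
  (fun s hs => @inv_increment (nd ^+ 2) k s (lt0r_neq0 (dk s hs)) k0).
move=> h; apply: le_trans (h _) _ => [s /[dup] hs /andP[s0 st]|].
  rewrite /k mulNr; apply: self_concordant_ub => //; have := dk s hs.
  by rewrite /k mulNr subr_gt0.
have := dk t; rewrite lexx t0 => /(_ isT) dt; have : 1 - M * nd * t = 1 + k * t.
  by rewrite /k mulNr.
move=> ->; rewrite le_eqVlt; apply/orP; left; apply/eqP.
by rewrite mulr0 addr0; field; rewrite k0 gt_eqF.
Qed.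

Lemma self_concordant_increment_lb t : 0 <= t ->
  nd ^+ 2 * t / (1 + M * nd * t) <= q t - q 0.
Proof.
move=> t0; set k := M * nd.
have k0 : k != 0 by rewrite mulf_neq0 ?gt_eqF.
have dk s : 0 <= s <= t -> 0 < 1 + k * s.
  by move=> /andP[s0 st]; rewrite ltr_pwDl// !mulr_ge0// ltW.
have := ler_increment t0
  (fun s hs => @inv_increment (nd ^+ 2) k s (lt0r_neq0 (dk s hs)) k0)
  (fun s _ => q_derive s).
move=> h; apply: le_trans (h _) => [|s /andP[s0 st]].
  have := dk t; rewrite lexx t0 => /(_ isT) dt.
  rewrite le_eqVlt; apply/orP; left; apply/eqP.
  by rewrite mulr0 addr0; field; rewrite k0 gt_eqF.
exact: self_concordant_lb.
Qed.

End SelfConcordantLine.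

(** * The adaptive step along a line *)

Section AdaptiveStep.
Context {R : realType}.
Variables (M l mu : R) (f0 f1 f2 f3 : R -> R) (eta : R).
Hypothesis M_gt0 : 0 < M.
Hypothesis l_gt0 : 0 < l.
Hypothesis mu_gt0 : 0 < mu.
Hypothesis eta_gt0 : 0 < eta.
Hypothesis f0_derive : forall t, is_derive t (1 : R) f0 (f1 t).
Hypothesis f1_derive : forall t, is_derive t (1 : R) f1 (f2 t).
Hypothesis f2_derive : forall t, is_derive t (1 : R) f2 (f3 t).
Hypothesis f2_gt0 : forall t, 0 < f2 t.
Hypothesis f3_le : forall t, `|f3 t| <= 2 * M * Num.sqrt (f2 t) ^+ 3.
Hypothesis f1_lip : forall s t : R, s <= t -> f1 t - f1 s <= l * (t - s).
Hypothesis f1_mono : forall s t : R, s <= t -> mu * (t - s) <= f1 t - f1 s.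
Let nd : R := Num.sqrt (f2 0).
Hypothesis f1_0 : f1 0 = - (eta * nd).
Variable alpha : R.
Hypothesis alpha_gt0 : 0 < alpha.
Hypothesis alpha_sqr : l * alpha ^+ 2 = nd ^+ 2.

(** The adaptive step in scalar form. In this section [f0], ..., [f3] stand for t |-> f(x + t d) and
    its derivatives, [nd] for |d|_x, and [l], [mu] for L |d|^2, mu |d|^2. *)
Definition line_step (M eta alpha nd : R) : R :=
  if (1 + M * eta) * alpha <= 1
  then eta / ((1 + M * eta) * nd)
  else (M * eta * alpha ^+ 2 + (1 - alpha) ^+ 2) / (M * nd).
Let tt := line_step M eta alpha nd.
Let z := M * eta.

Let z_gt0 : 0 < z. Proof. exact: mulr_gt0. Qed.
Let nd_gt0 : 0 < nd. Proof. by rewrite sqrtr_gt0. Qed.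

Let increment_ub (t : R) : 0 <= t -> M * nd * t < 1 ->
  f1 t - f1 0 <= nd ^+ 2 * t / (1 - M * nd * t).
Proof. exact: (self_concordant_increment_ub M_gt0 f2_derive f2_gt0 f3_le). Qed.

Let increment_lb (t : R) : 0 <= t ->
  nd ^+ 2 * t / (1 + M * nd * t) <= f1 t - f1 0.
Proof. exact: (self_concordant_increment_lb M_gt0 f2_derive f2_gt0 f3_le). Qed.

Let alpha_le1 : alpha <= 1.
Proof.
rewrite leNgt; apply/negP => a1.
have nl : l < nd ^+ 2.
  rewrite -alpha_sqr -[ltLHS]mulr1 ltr_pM2l//.
  by rewrite exprn_egt1// ltW.
(* Chosen so that l (1 + M nd t) is the midpoint of [l] and nd^2; the two bounds on the increment of
   [f1] would then force nd^2 to be at most this midpoint. *)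
set t := (nd ^+ 2 - l) / (2 * l * M * nd).
have t0 : 0 < t by rewrite divr_gt0 ?subr_gt0// !mulr_gt0.
have := le_trans (increment_lb (ltW t0)) (f1_lip (ltW t0)).
rewrite subr0 ler_pdivrMr; last first.
  by rewrite ltr_pwDl// mulr_ge0 ?(ltW t0)// mulr_ge0// ltW.
rewrite [leRHS]mulrAC ler_pM2r//.
suff -> : l * (1 + M * nd * t) = l + (nd ^+ 2 - l) / 2 by lra.
by rewrite /t; field; rewrite !gt_eqF.
Qed.

Let q := M * nd * tt.

Let qE : q = if (1 + z) * alpha <= 1 then z / (1 + z)
             else z * alpha ^+ 2 + (1 - alpha) ^+ 2.
Proof.
have z1 : 1 + z != 0 by rewrite gt_eqF// ltr_pwDl// ltW.
rewrite /q /tt /line_step -/z; case: ifP => _.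
  by rewrite /z in z1 *; field; rewrite z1 gt_eqF.
by field; rewrite !gt_eqF.
Qed.

(** The step is never shorter than the one from the self-concordant model alone: in the second case
    the excess is a square over 1 + z. *)
Let q_ge : z / (1 + z) <= q.
Proof.
rewrite qE; case: (leP ((1 + z) * alpha) 1) => // za.
have z1 : 0 < 1 + z by rewrite ltr_pwDl// ltW.
rewrite ler_pdivrMr// -subr_ge0.
suff -> : (z * alpha ^+ 2 + (1 - alpha) ^+ 2) * (1 + z) - z =
  (alpha * (1 + z) - 1) ^+ 2 by rewrite sqr_ge0.
by ring.
Qed.

(** In terms of the step: [tt] is at least eta nd / l, the step of the quadratic model with
    curvature [l]. *)
Let q_ge_alpha : z * alpha ^+ 2 <= q.
Proof.
rewrite qE; case: (leP ((1 + z) * alpha) 1) => za; last first.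
  by rewrite lerDl sqr_ge0.
have z1 : 0 < 1 + z by rewrite ltr_pwDl// ltW.
rewrite ler_pdivlMr// -mulrA ger_pMr// expr2 -mulrA.
by rewrite [alpha * (1 + z)]mulrC -[leRHS]mulr1 ler_pM// ?mulr_ge0// ltW.
Qed.

Let q_gt0 : 0 < q.
Proof. by apply: lt_le_trans q_ge; rewrite divr_gt0// ltr_pwDl// ltW. Qed.

Lemma line_step_gt0 : 0 < tt.
Proof. by move: q_gt0; rewrite /q pmulr_rgt0// mulr_gt0. Qed.
Let tt_gt0 := line_step_gt0.

(** The majorant of f1 - f1(0) is convex, vanishes at 0 and equals eta nd at [tt], so it lies below
    its chord. The cases are: [tt] in the self-concordant regime; otherwise [t] before or after the
    switch to slope [l]. *)
Lemma increment_le_chord (t : R) : 0 <= t <= tt ->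
  f1 t - f1 0 <= eta * nd / tt * t.
Proof.
move=> /andP[t0 ttt]; have a0 := alpha_gt0.
have sE : eta * nd / tt = nd ^+ 2 * (z / q).
  by rewrite /z /q; field; rewrite !gt_eqF.
have Mt : M * nd * t <= q by rewrite ler_wpM2l// mulr_ge0// ltW.
have Mt0 : 0 <= M * nd * t by rewrite !mulr_ge0// ltW.
have z1 : 0 < 1 + z by rewrite ltr_pwDl// ltW.
have [za|za] := leP ((1 + z) * alpha) 1.
  have qe : q = z / (1 + z) by rewrite qE za.
  have q1 : 1 - q = (1 + z)^-1 by rewrite qe; field; rewrite gt_eqF.
  have q1_gt0 : 0 < 1 - q by rewrite q1 invr_gt0.
  have ut : 0 < 1 - M * nd * t by lra.
  apply: (le_trans (increment_ub t0 _)); first by lra.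
  rewrite sE mulrAC ler_wpM2r// ler_wpM2l ?sqr_ge0//.
  have -> : z / q = (1 - q)^-1.
    by rewrite q1 qe; field; rewrite !gt_eqF.
  by rewrite lef_pV2 ?posrE//; lra.
have qe : q = z * alpha ^+ 2 + (1 - alpha) ^+ 2 by rewrite qE leNgt za.
(* Equivalent to q <= z alpha: the chord is at least as steep as the self-concordant majorant
   averaged up to the switching point. *)
have zq : alpha^-1 <= z / q.
  rewrite -[leLHS]mul1r ler_pdivrMr// mulrAC ler_pdivlMr// mul1r qe.
  have : 0 <= (1 - alpha) * ((1 + z) * alpha - 1).
    by rewrite mulr_ge0 ?subr_ge0// ltW.
  by nra.
have [ta|ta] := leP (M * nd * t) (1 - alpha).
  have ut : 0 < 1 - M * nd * t.
    by rewrite subr_gt0 (le_lt_trans ta)// ltrBlDr ltrDl.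
  apply: (le_trans (increment_ub t0 _)); first by lra.
  rewrite sE mulrAC ler_wpM2r// ler_wpM2l ?sqr_ge0//.
  by apply: le_trans zq; rewrite lef_pV2 ?posrE//; lra.
(* The switching point: there 1 - M nd t = alpha, so the self-concordant bound on [f2] reaches nd^2
   / alpha^2 = l. *)
set t1 := (1 - alpha) / (M * nd).
have Mnd : 0 < M * nd by exact: mulr_gt0.
have Mt1 : M * nd * t1 = 1 - alpha by rewrite /t1; field; rewrite !gt_eqF.
have t10 : 0 <= t1 by rewrite divr_ge0 ?subr_ge0// ltW.
have t1t : t1 <= t by rewrite ler_pdivrMr// mulrC ltW.
have h1 : f1 t1 - f1 0 <= nd ^+ 2 * t1 / alpha.
  apply: (le_trans (increment_ub t10 _)); first by lra.
  by rewrite Mt1 opprB addrCA subrr addr0.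
have h2 := f1_lip t1t.
have lE : l = nd ^+ 2 / alpha ^+ 2.
  by rewrite -alpha_sqr mulfK// expf_neq0// gt_eqF.
(* The piecewise-linear majorant meets the chord at [tt] and lies below it at
   [t1]. *)
have atend : nd ^+ 2 * t1 / alpha + l * (tt - t1) = eta * nd.
  have ttE : tt = q / (M * nd) by rewrite /q; field; rewrite !gt_eqF.
  rewrite ttE qe lE /t1 /z; field; rewrite !gt_eqF//.
(* Beyond [t1] the majorant has slope [l] and ends at eta nd in [tt]; a chord with the same endpoint
   and slope at most [l] stays above it. *)
have slope : eta * nd / tt <= l.
  rewrite sE lE ler_wpM2l ?sqr_ge0//.
  by rewrite ler_pdivrMr// mulrC ler_pdivlMr// exprn_gt0.
have : l * (tt - t) >= eta * nd / tt * (tt - t) by rewrite ler_wpM2r// subr_ge0.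
rewrite [eta * nd / tt * (_ - _)]mulrBr divfK ?gt_eqF//.
move: h1 h2 atend; set a := nd ^+ 2 * t1 / alpha; set b := eta * nd / tt * t.
rewrite !mulrBr; lra.
Qed.

(** By the chord bound f1(t) <= -eta nd (1 - t / tt), and the area of that triangle is the claimed
    decrease. *)
Lemma line_step_decrease : eta * nd * tt / 2 <= f0 0 - f0 tt.
Proof.
have slope t : 0 <= t <= tt ->
    f1 t <= 2 * (eta * nd / tt / 2) * t + - (eta * nd).
  by move=> /increment_le_chord; rewrite f1_0; set b := _ / tt; lra.
have := ler_increment (ltW tt_gt0) (fun t _ => f0_derive t)
  (fun t _ => is_derive_quad (eta * nd / tt / 2) (- (eta * nd)) t) slope.
have -> : eta * nd / tt / 2 * tt ^+ 2 = eta * nd * tt / 2.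
  by field; rewrite gt_eqF.
by rewrite expr0n/= !mulr0; lra.
Qed.

(** Strong monotonicity of [f1] over a step of length at least eta nd / l. *)
Lemma line_step_curvature_kappa :
  eta * nd * (mu / l) <= f1 tt - f1 0.
Proof.
apply: le_trans (f1_mono (ltW tt_gt0)); rewrite subr0.
rewrite mulrCA ler_pM2l// ler_pdivrMr//.
have -> : tt = q / (M * nd) by rewrite /q; field; rewrite !gt_eqF.
rewrite mulrAC ler_pdivlMr ?mulr_gt0//.
have -> : eta * nd * (M * nd) = z * alpha ^+ 2 * l.
  by rewrite -[RHS]mulrA (mulrC (alpha ^+ 2)) alpha_sqr /z; ring.
by rewrite ler_pM2r.
Qed.

(** The lower bound nd q / (M (1 + q)) on the increment increases with [q]; inserting q >= z / (1 +
    z) produces the denominator 1 + 2 z. *)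
Lemma line_step_curvature_eta :
  eta * nd / (1 + 2 * (M * eta)) <= f1 tt - f1 0.
Proof.
apply: le_trans (increment_lb (ltW tt_gt0)).
rewrite -/q -/z.
have z1 : 0 < 1 + z by rewrite ltr_pwDl// ltW.
have z2 : 0 < 1 + 2 * z by rewrite ltr_pwDl// mulr_ge0// ltW.
have -> : nd ^+ 2 * tt = nd * q / M by rewrite /q; field; rewrite gt_eqF.
have -> : eta * nd = nd * z / M by rewrite /z; field; rewrite gt_eqF.
have q0 := q_gt0; have q1 : 0 < 1 + q by lra.
rewrite ler_pdivrMr// [leRHS]mulrAC ler_pdivlMr// -subr_ge0.
have -> : nd * q / M * (1 + 2 * z) - nd * z / M * (1 + q) =
  nd / M * (q * (1 + z) - z) by ring.
apply: mulr_ge0; first by rewrite divr_ge0// ltW.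
by rewrite subr_ge0 -ler_pdivrMr.
Qed.

(* Minimising the self-concordant model alone, at [t = eta / ((1 + z) nd)]. *)
Lemma newton_decrement_bound fmin : (forall t, fmin <= f0 t) ->
  z - ln (1 + z) <= M ^+ 2 * (f0 0 - fmin).
Proof.
move=> fmin_le.
have z1 : 0 < 1 + z by rewrite ltr_pwDl// ltW.
set t0 := z / (1 + z) / (M * nd).
have Mnd : 0 < M * nd by exact: mulr_gt0.
have t0_gt0 : 0 < t0 by rewrite !divr_gt0.
have Mt0 : M * nd * t0 = z / (1 + z) by rewrite /t0; field; rewrite !gt_eqF.
have pos (t : R) : 0 <= t <= t0 -> 0 < 1 - M * nd * t.
  move=> /andP[_ tt0]; have : M * nd * t <= M * nd * t0 by rewrite ler_pM2l.
  rewrite Mt0; have : z / (1 + z) < 1 by rewrite ltr_pdivrMr//; lra.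
  by set u := M * nd * t; lra.
(* [G] is the antiderivative, zero at 0, of the self-concordant upper bound [G'] on [f1]; its value
   at [t0] is (ln(1 + z) - z) / M^2. *)
pose G (t : R) : R :=
  - (M ^+ 2)^-1 * ln (1 - M * nd * t) - (eta * nd + nd / M) * t.
pose G' (t : R) : R := - (eta * nd) + nd ^+ 2 * t / (1 - M * nd * t).
have dG (t : R) : 0 <= t <= t0 -> is_derive t (1 : R) G (G' t).
  move=> /pos ut.
  have d1 : is_derive t (1 : R) (fun s : R => 1 - M * nd * s) (- (M * nd)).
    have h : is_derive t (1 : R) (cst 1 + (- (M * nd)) *: (@id R))
        (0 + (- (M * nd)) *: 1).
      exact: is_deriveD.
    have -> : (fun s : R => 1 - M * nd * s) = cst 1 + (- (M * nd)) *: (@id R).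
      by apply/funext => s; rewrite -[RHS]/(1 + (- (M * nd)) * s) mulNr.
    by apply: is_derive_eq h _; rewrite /GRing.scale/= mulr1 add0r.
  have d2 := @is_derive1_comp R (@ln R) (fun s => 1 - M * nd * s) t _ _
    (is_derive1_ln ut) d1.
  have h : is_derive t (1 : R)
      ((- (M ^+ 2)^-1) *: (@ln R \o (fun s : R => 1 - M * nd * s))
        - (eta * nd + nd / M) *: (@id R)) (_ - _) :=
    is_deriveB (is_deriveZ _ d2) (is_deriveZ _ (is_derive_id _ _)).
  apply: is_derive_eq h _; rewrite /GRing.scale/= /G'.
  by field; rewrite !gt_eqF.
have := ler_increment (ltW t0_gt0) (fun t _ => f0_derive t) dG.
have ub (t : R) : 0 <= t <= t0 -> f1 t <= G' t.
  move=> /[dup] /pos ut /andP[tge0 _]; rewrite /G' -f1_0 -lerBlDl.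
  by apply: increment_ub => //; rewrite -subr_gt0.
move=> /(_ ub).
have -> : G 0 = 0 by rewrite /G !mulr0 !subr0 ln1 mulr0.
have -> : G t0 = (M ^+ 2)^-1 * (ln (1 + z) - z).
  rewrite /G Mt0; have -> : 1 - z / (1 + z) = (1 + z)^-1.
    by field; rewrite gt_eqF.
  rewrite lnV ?posrE// /t0 /z; field.
  by rewrite !gt_eqF.
rewrite subr0 ler_pdivlMl ?exprn_gt0// => h.
have : M ^+ 2 * (fmin - f0 0) <= M ^+ 2 * (f0 t0 - f0 0).
  by rewrite ler_pM2l ?exprn_gt0// lerB.
move: h; rewrite -/z; set a := ln _; set b := M ^+ 2.
by rewrite !mulrBr; lra.
Qed.

End AdaptiveStep.

(** * Strongly convex functions with Lipschitz gradient *)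

(** Right difference quotients suffice. Increments in (0, 1) match the range in which convexity
    inequalities are available. *)
Lemma derive_ge_slope (R : realType) (F : R -> R) (t c m : R) :
  is_derive t (1 : R) F c ->
  (forall h, 0 < h < 1 -> m * h <= F (t + h) - F t) -> m <= c.
Proof.
move=> [dF Fc] mF; rewrite -Fc.
have cv := cvg_dnbhs_at_right dF.
have -> : 'D_1 F t =
    lim (h^-1 *: ((F \o shift t) (h *: 1) - F t) @[h --> 0^'+]).
  by rewrite /derive; apply/esym/cvg_lim.
apply: limr_ge; first by apply/cvg_ex; eexists; exact: cv.
near=> h.
have h0 : 0 < h by [].
have h1 : h < 1 by near: h; exact: nbhs_right_lt.
rewrite /GRing.scale/= mulr1 mulrC ler_pdivlMr// [h + t]addrC.
by apply: mF; rewrite h0 h1.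
Unshelve. all: by end_near.
Qed.

(** * Directional derivatives, gradient and Hessian along a line *)

Section Line.
Context {R : realType} {n : nat}.
Implicit Types (f : 'cV[R]_n -> R) (x d v : 'cV[R]_n).

Lemma is_derive_line f x d (t : R) : differentiable f (x + t *: d) ->
  is_derive t (1 : R) (fun s : R => f (x + s *: d)) ('D_d f (x + t *: d)).
Proof.
move=> df.
have e : (fun h : R => h^-1 *:
    (((fun s : R => f (x + s *: d)) \o shift t) (h *: 1) - f (x + t *: d))) =
  (fun h : R => h^-1 *: ((f \o shift (x + t *: d)) (h *: d) - f (x + t *: d))).
  apply/funext => h; congr (_ *: (f _ - _)).
  by rewrite /= [h *: 1]mulr1 scalerDl addrCA.
split; last by rewrite /derive e.
by rewrite /derivable e; exact: diff_derivable.
Qed.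

Lemma derive_coord f x v : differentiable f x ->
  'D_v f x = \sum_i v i 0 * 'D_(basis_vec i) f x.
Proof.
move=> df; have vE : v = \sum_i v i 0 *: basis_vec i.
  apply/colP => j; rewrite summxE (bigD1 j)//= big1 ?addr0 => [|i ij].
    by rewrite !mxE !eqxx mulr1.
  by rewrite !mxE eq_sym (negbTE ij) mulr0.
rewrite deriveE// [in LHS]vE linear_sum; apply: eq_bigr => i _.
by rewrite linearZ/= deriveE.
Qed.

Lemma derive_grad f x v : differentiable f x -> 'D_v f x = dotv (grad f x) v.
Proof.
move=> df; rewrite derive_coord// dotvE; apply: eq_bigr => i _.
by rewrite mxE mulrC.
Qed.

Lemma derive2_hess f x d : (forall y, differentiable f y) ->
  (forall v y, differentiable ('D_v f) y) ->
  'D_d ('D_d f) x = dotv d (hess f x *m d).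
Proof.
move=> df ddf; rewrite derive_coord// dotvE; apply: eq_bigr => i _.
congr (_ * _); rewrite mxE.
have -> : 'D_d f = \sum_j (d j 0 *: 'D_(basis_vec j) f).
  apply/funext => y; rewrite derive_coord// fct_sumE.
  by apply: eq_bigr.
rewrite derive_sum => [|j]; last by apply: derivableZ; exact: diff_derivable.
apply: eq_bigr => j _; rewrite deriveZ; last exact: diff_derivable.
by rewrite mxE mulrC.
Qed.

End Line.

(** * First-order inequalities from strong convexity and smoothness *)

Section StronglyConvexSmooth.
Context {R : realType} {n : nat}.
Variables (mu L : R) (f : 'cV[R]_n -> R).
Hypothesis mu_gt0 : 0 < mu.
Hypothesis L_gt0 : 0 < L.
Hypothesis f_diff : forall x, differentiable f x.
Hypothesis f_sc : strongly_convex mu f.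
Hypothesis f_lip : lipschitz_grad L f.
Implicit Types x y v d : 'cV[R]_n.

Let is_derive_f x d (t : R) :
  is_derive t (1 : R) (fun s : R => f (x + s *: d))
    (dotv (grad f (x + t *: d)) d).
Proof. by rewrite -derive_grad//; exact: is_derive_line. Qed.

(** The gap between the convexity bound and f(x + h v), with v = y - x, is zero at h = 0 and
    nonnegative for 0 < h < 1, so its derivative at 0 is nonnegative. *)
Lemma strongly_convex_grad x y :
  f x + dotv (grad f x) (y - x) + mu / 2 * dotv (y - x) (y - x) <= f y.
Proof.
set v := y - x; set N := dotv v v.
have d1 := is_derive_f x v 0; rewrite scale0r addr0 in d1.
have d2 := is_derive_quad (mu / 2 * N) (f y - f x - mu / 2 * N) 0.
have d3 := is_deriveB d2 d1.
have := @derive_ge_slope R _ _ _ 0 d3; rewrite mulr0 add0r => h.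
suff : 0 <= f y - f x - mu / 2 * N - dotv (grad f x) v by lra.
apply: h => h /andP[h0 h1].
rewrite !fctE mul0r add0r scale0r addr0 expr0n/= !mulr0 addr0.
have := @f_sc y x h; rewrite (ltW h0) (ltW h1) => /(_ isT).
rewrite enorm_sqr -/v -/N.
have -> : h *: y + (1 - h) *: x = x + h *: v.
  by rewrite /v scalerBl scale1r scalerBr addrCA.
by rewrite -subr_ge0 => H; rewrite -subr_ge0; apply: le_trans H _; lra.
Qed.

Lemma grad_strongly_monotone x y :
  mu * dotv (y - x) (y - x) <= dotv (grad f y - grad f x) (y - x).
Proof.
have := strongly_convex_grad x y; have := strongly_convex_grad y x.
rewrite -[x - y]opprB !dotv_lin.
set a := dotv (grad f x) y; set b := dotv (grad f y) y.
set c := dotv (grad f x) x; set e := dotv (grad f y) x.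
by rewrite (dotvC x y); lra.
Qed.

Lemma smooth_ub x v :
  f (x + v) <= f x + dotv (grad f x) v + L / 2 * dotv v v.
Proof.
have := ler_increment (@ler01 R) (fun t _ => is_derive_f x v t)
  (fun t _ => is_derive_quad (L / 2 * dotv v v) (dotv (grad f x) v) t).
rewrite scale1r scale0r addr0 => h.
suff : forall t : R, 0 <= t <= 1 -> dotv (grad f (x + t *: v)) v
    <= 2 * (L / 2 * dotv v v) * t + dotv (grad f x) v.
  by move=> /h; lra.
move=> t /andP[t0 _].
rewrite -lerBlDr -dotvBl; apply: (le_trans (dotv_CauchySchwarz _ _)).
have := f_lip (x + t *: v) x; rewrite [x + _]addrC addrK => hl.
apply: (le_trans (ler_wpM2r (sqrtr_ge0 _) hl)).
have -> : enorm (t *: v) = t * enorm v.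
  rewrite /enorm !dotv_lin mulrA -expr2 sqrtrM ?sqr_ge0// sqrtr_sqr.
  by rewrite ger0_norm.
rewrite (_ : L * (t * enorm v) * enorm v = L * t * enorm v ^+ 2); last by ring.
by rewrite enorm_sqr; lra.
Qed.

Lemma grad_cocoercive x y :
  dotv (grad f y - grad f x) (grad f y - grad f x)
    <= L * dotv (grad f y - grad f x) (y - x).
Proof.
(* Adding [H] for (x, y) and for (y, x) cancels the function values. *)
suff H a b : f a + dotv (grad f a) (b - a) +
    dotv (grad f b - grad f a) (grad f b - grad f a) / (2 * L) <= f b.
  have := H x y; have := H y x.
  have -> : grad f x - grad f y = - (grad f y - grad f x) by rewrite opprB.
  rewrite -[x - y]opprB [dotv (- _) (- _)]dotvNl dotvNr opprK dotvNr.
  rewrite [X in _ -> _ -> _ <= X]mulrC -ler_pdivrMr//.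
  set g := grad f y - grad f x.
  have -> : dotv g (y - x) = dotv (grad f y) (y - x) - dotv (grad f x) (y - x).
    by rewrite dotvBl.
  have -> : dotv g g / L = 2 * (dotv g g / (2 * L)) by field; rewrite gt_eqF.
  by lra.
set g := grad f b - grad f a.
(* The point b - g / L minimises the quadratic upper model at [b] of [f] minus its linear part at
   [a]; there the model is compared with the tangent plane at [a]. *)
have h1 := smooth_ub b (- (L^-1 *: g)).
have h2 := strongly_convex_grad a (b - L^-1 *: g).
have h3 : 0 <= mu / 2 * dotv (b - L^-1 *: g - a) (b - L^-1 *: g - a).
  by rewrite mulr_ge0 ?dotvv_ge0// divr_ge0// ltW.
have e : dotv (grad f b) g - dotv (grad f a) g = dotv g g by rewrite -dotvBl.
move: h1 h2 h3; set S := mu / 2 * _.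
rewrite !(dotvBr (grad f a)) !(dotvNl, dotvNr) opprK !(dotvZl, dotvZr).
have -> : L / 2 * (L^-1 * (L^-1 * dotv g g)) = dotv g g / (2 * L).
  by field; rewrite gt_eqF.
have -> : dotv g g / (2 * L) = L^-1 * dotv g g / 2 by field; rewrite gt_eqF.
rewrite -e mulrBr.
by lra.
Qed.

(** The Polyak-Lojasiewicz inequality: the strong convexity lower bound at [xstar], with the square
    |grad f(x) + mu v|^2 completed. *)
Lemma grad_dominated xstar x :
  2 * mu * (f x - f xstar) <= dotv (grad f x) (grad f x).
Proof.
have := strongly_convex_grad x xstar; move: (xstar - x) => v h.
have := dotvv_ge0 (grad f x + mu *: v).
rewrite !dotv_lin (dotvC v) => h2.
have : 2 * mu * (f x + dotv (grad f x) v + mu / 2 * dotv v v) <=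
    2 * mu * f xstar.
  by rewrite ler_pM2l// mulr_gt0.
by move: h2; rewrite mulrBr; lra.
Qed.

(** A gradient step of length 1 / L lowers [f] by at least |grad f(x)|^2 / (2 L). *)
Lemma not_minimizer_gt xstar x : is_minimizer f xstar -> grad f x != 0 ->
  f xstar < f x.
Proof.
move=> fmin g0; apply: le_lt_trans (fmin (x - L^-1 *: grad f x)) _.
apply: le_lt_trans (smooth_ub _ _) _.
rewrite !dotv_lin !mulrN opprK; have := dotvv_gt0 g0; set N := dotv _ _ => N0.
have -> : L / 2 * (L^-1 * (L^-1 * N)) = L^-1 * N / 2 by field; rewrite gt_eqF.
have : 0 < L^-1 * N by rewrite mulr_gt0 ?invr_gt0.
by lra.
Qed.

End StronglyConvexSmooth.

(** * One iteration *)

Lemma expR_ge_quad (R : realType) (w : R) : 0 <= w ->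
  1 + w + w ^+ 2 / 2 <= expR w.
Proof.
move=> w0.
have := ler_increment w0 (fun t _ => is_derive_quad (2^-1) 1 t)
  (fun t _ => is_derive_expR t).
rewrite expR0 expr0n/= !mulr0 addr0 => h.
suff : forall t : R, 0 <= t <= w -> 2 * 2^-1 * t + 1 <= expR t.
  by move=> /h; lra.
by move=> t _; rewrite mulfV ?mul1r 1?addrC ?expR_ge1Dx// pnatr_eq0.
Qed.

(** At v = w + w^2 / 2 one has ln(1 + v) <= w, hence v - ln(1 + v) >= w^2 / 2. As z - ln(1 + z) is
    strictly increasing, z <= v, and 1 + 2 v = (1 + w)^2. *)
Lemma newton_decrement_le (R : realType) (z w : R) : 0 < z -> 0 < w ->
  z - ln (1 + z) <= w ^+ 2 / 2 -> 1 + 2 * z <= (1 + w) ^+ 2.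
Proof.
move=> z0 w0 h; suff : z <= w + w ^+ 2 / 2 by rewrite sqrrD expr1n mul1r; lra.
rewrite leNgt; apply/negP => zw.
have w2 : 0 < w ^+ 2 by rewrite exprn_gt0.
set v := w + w ^+ 2 / 2 in zw.
have v0 : 0 < v by rewrite /v; lra.
have lnv : ln (1 + v) <= w.
  rewrite -ler_expR lnK ?posrE; last by lra.
  by rewrite /v addrA expR_ge_quad// ltW.
have v1 : 0 < 1 + v by lra.
have qE : (1 + z) / (1 + v) = 1 + (z - v) / (1 + v).
  by field; rewrite gt_eqF.
have : ln ((1 + z) / (1 + v)) <= (z - v) / (1 + v).
  rewrite qE le_ln1Dx// (lt_trans (ltrN10 _))// divr_gt0 ?subr_gt0//.
rewrite ln_div ?posrE//; last by lra.
have : (z - v) / (1 + v) < z - v.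
  by rewrite ltr_pdivrMr// ltr_pMr ?subr_gt0//; lra.
have vE : v = w + w ^+ 2 / 2 by [].
by move: h lnv; set q := (z - v) / _; set lz := ln _; set lv := ln _; lra.
Qed.

Section OneStep.
Context {R : realType} {n : nat}.
Variables (mu L M : R) (f : 'cV[R]_n -> R).
Hypothesis mu_gt0 : 0 < mu.
Hypothesis L_gt0 : 0 < L.
Hypothesis M_gt0 : 0 < M.
Hypothesis f_C3 : cont_diff 3 f.
Hypothesis f_sc : strongly_convex mu f.
Hypothesis f_lip : lipschitz_grad L f.
Hypothesis f_conc : self_concordant M f.
Implicit Types x d s : 'cV[R]_n.

Let f_diff x : differentiable f x. Proof. exact: f_C3.1. Qed.
Let f_diff1 v x : differentiable ('D_v f) x. Proof. exact: (f_C3.2 v).1. Qed.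
Let f_diff2 u v x : differentiable ('D_u ('D_v f)) x.
Proof. exact: ((f_C3.2 v).2 u).1. Qed.

Lemma local_norm_derive x d : local_norm f x d = Num.sqrt ('D_d ('D_d f) x).
Proof. by rewrite /local_norm derive2_hess. Qed.

Lemma derive_line_mono x d (s t : R) : s <= t ->
  mu * dotv d d * (t - s) <= 'D_d f (x + t *: d) - 'D_d f (x + s *: d).
Proof.
move=> st; have [->|/eqP] := eqVneq s t; first by rewrite !subrr mulr0.
move=> /eqP nst; have ts : 0 < t - s by rewrite subr_gt0 lt_neqAle nst.
rewrite !derive_grad// -dotvBl -(ler_pM2r ts).
have := grad_strongly_monotone f_diff f_sc (x + s *: d) (x + t *: d).
have -> : x + t *: d - (x + s *: d) = (t - s) *: d.
  by rewrite opprD addrACA subrr add0r scalerBl.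
rewrite dotvZl !dotvZr => h; rewrite [leRHS]mulrC; apply: le_trans h.
by rewrite le_eqVlt; apply/orP; left; apply/eqP; ring.
Qed.

Lemma derive_line_lip x d (s t : R) : s <= t ->
  'D_d f (x + t *: d) - 'D_d f (x + s *: d) <= L * dotv d d * (t - s).
Proof.
move=> st; rewrite !derive_grad// -dotvBl.
apply: (le_trans (dotv_CauchySchwarz _ _)).
apply: (le_trans (ler_wpM2r (sqrtr_ge0 _) (f_lip _ _))).
have -> : x + t *: d - (x + s *: d) = (t - s) *: d.
  by rewrite opprD addrACA subrr add0r scalerBl.
have -> : enorm ((t - s) *: d) = (t - s) * enorm d.
  rewrite /enorm !dotv_lin mulrA -expr2 sqrtrM ?sqr_ge0// sqrtr_sqr.
  by rewrite ger0_norm// subr_ge0.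
have -> : L * ((t - s) * enorm d) * enorm d = L * enorm d ^+ 2 * (t - s).
  by ring.
by rewrite enorm_sqr.
Qed.

Lemma derive2_gt0 x d : d != 0 -> 0 < 'D_d ('D_d f) x.
Proof.
move=> d0; apply: lt_le_trans (_ : mu * dotv d d <= _).
  by rewrite mulr_gt0// dotvv_gt0.
have := @is_derive_line R n ('D_d f) x d 0; rewrite scale0r addr0 => h.
apply: derive_ge_slope (h (f_diff1 _ _)) _ => t /andP[t0 _].
by have := @derive_line_mono x d 0 t (ltW t0); rewrite subr0 add0r.
Qed.

Variables (xstar : 'cV[R]_n).
Hypothesis xstar_min : is_minimizer f xstar.

Variables (x : 'cV[R]_n) (B : 'M[R]_n).
Hypothesis B_pd : sym_posdef B.
Hypothesis g_neq0 : grad f x != 0.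
Let d := bfgs_direction f x B.
Let xp := x + adaptive_step M L f x d *: d.
Let Bp := bfgs_update B (xp - x) (grad f xp - grad f x).
Let Delta := f x - f xstar.

Let B_unit : B \in unitmx.
Proof. by rewrite unitmxE unitfE gt_eqF//; case: (sym_posdef_Psi B_pd). Qed.

Let Bd : B *m d = - grad f x.
Proof. by rewrite /d /bfgs_direction mulmxN mulKVmx. Qed.

Let d_neq0 : d != 0.
Proof.
by apply: contra_neq g_neq0 => d0; rewrite -[LHS]opprK -Bd d0 mulmx0 oppr0.
Qed.

Let gd_gt0 : 0 < - dotv (grad f x) d.
Proof. by rewrite -dotvNl -Bd dotvC; apply: B_pd.2. Qed.

Let Delta_gt0 : 0 < Delta.
Proof. by rewrite subr_gt0; exact: (not_minimizer_gt L_gt0 f_diff f_lip). Qed.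

Let e := - dotv (grad f x) d.
Let mk := Num.min (L / mu) ((1 + Num.sqrt 2 * M * Num.sqrt Delta) ^+ 2).

Let step_props : exists t : R, [/\ 0 < t, xp = x + t *: d,
  e * t / 2 <= f x - f xp &
  e / mk <= dotv (grad f xp - grad f x) d].
Proof.
pose p := fun F : 'cV[R]_n -> R => fun t : R => F (x + t *: d).
have p0 F : p F 0 = F x by rewrite /p scale0r addr0.
have dN := dotvv_gt0 d_neq0.
have nd_gt0 : 0 < local_norm f x d.
  by rewrite local_norm_derive sqrtr_gt0 derive2_gt0.
have l_gt0 : 0 < L * dotv d d by rewrite mulr_gt0.
have m_gt0 : 0 < mu * dotv d d by rewrite mulr_gt0.
have eta_gt0 : 0 < - dotv (grad f x) d / local_norm f x d by rewrite divr_gt0.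
have nE : local_norm f x d = Num.sqrt (p ('D_d ('D_d f)) 0).
  by rewrite p0 local_norm_derive.
have d0 t : is_derive t (1 : R) (p f) (p ('D_d f) t) by exact: is_derive_line.
have d1 t : is_derive t (1 : R) (p ('D_d f)) (p ('D_d ('D_d f)) t).
  exact: is_derive_line.
have d2 t : is_derive t (1 : R) (p ('D_d ('D_d f)))
    (p ('D_d ('D_d ('D_d f))) t).
  exact: is_derive_line.
have f2_gt0 t : 0 < p ('D_d ('D_d f)) t by exact: derive2_gt0.
have f3_le t : `|p ('D_d ('D_d ('D_d f))) t| <=
    2 * M * Num.sqrt (p ('D_d ('D_d f)) t) ^+ 3.
  by have := f_conc.2 (x + t *: d) d; rewrite local_norm_derive.
have al_gt0 : 0 < local_norm f x d / (Num.sqrt L * enorm d).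
  by rewrite divr_gt0// mulr_gt0 ?sqrtr_gt0.
have al_sqr : L * dotv d d * (local_norm f x d / (Num.sqrt L * enorm d)) ^+ 2 =
    Num.sqrt (p ('D_d ('D_d f)) 0) ^+ 2.
  rewrite -nE expr_div_n exprMn enorm_sqr.
  rewrite [Num.sqrt L ^+ 2]sqr_sqrtr ?(ltW L_gt0)//.
  by rewrite mulrC divfK// gt_eqF.
have f1_0 : p ('D_d f) 0 = - (- dotv (grad f x) d / local_norm f x d *
    Num.sqrt (p ('D_d ('D_d f)) 0)).
  by rewrite -nE divfK ?gt_eqF// opprK p0 derive_grad.
have tE : adaptive_step M L f x d = line_step M
    (- dotv (grad f x) d / local_norm f x d)
    (local_norm f x d / (Num.sqrt L * enorm d))
    (Num.sqrt (p ('D_d ('D_d f)) 0)).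
  by rewrite -nE.
have eE : - dotv (grad f x) d / local_norm f x d *
    Num.sqrt (p ('D_d ('D_d f)) 0) = e by rewrite -nE divfK// gt_eqF.
have DE t : p ('D_d f) t - p ('D_d f) 0 =
    dotv (grad f (x + t *: d) - grad f x) d.
  by rewrite p0 /p !derive_grad// -dotvBl.
have t_gt0 := line_step_gt0 M_gt0 eta_gt0 f2_gt0
  (local_norm f x d / (Num.sqrt L * enorm d)).
have dec := line_step_decrease M_gt0 l_gt0 eta_gt0 d0 d1 d2 f2_gt0 f3_le
  (@derive_line_lip x d) f1_0 al_gt0 al_sqr.
have ck := line_step_curvature_kappa M_gt0 l_gt0 m_gt0 eta_gt0 d1 d2 f2_gt0
  f3_le (@derive_line_lip x d) (@derive_line_mono x d) al_gt0 al_sqr.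
have ce := line_step_curvature_eta M_gt0 eta_gt0 d1 d2 f2_gt0 f3_le
  (local_norm f x d / (Num.sqrt L * enorm d)).
have nb := newton_decrement_bound M_gt0 eta_gt0 d0 d1 d2 f2_gt0 f3_le f1_0
  (fun t => xstar_min (x + t *: d)).
move: dec ck ce nb; rewrite -tE eE DE p0 -/Delta => dec ck ce nb.
exists (adaptive_step M L f x d); split => //; first by rewrite tE.
have kE : mu * dotv d d / (L * dotv d d) = (L / mu)^-1.
  by field; rewrite !gt_eqF.
rewrite /mk.
have [_|_] := leP (L / mu) ((1 + Num.sqrt 2 * M * Num.sqrt Delta) ^+ 2).
  by rewrite -kE.
(* With w = sqrt 2 M sqrt Delta, the decrement bound M^2 Delta is w^2 / 2. *)
apply: le_trans ce; rewrite ler_pM2l// lef_pV2 ?posrE.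
- apply: newton_decrement_le; first by rewrite mulr_gt0.
    by rewrite !mulr_gt0 ?sqrtr_gt0.
  apply: le_trans nb _; rewrite !exprMn !sqr_sqrtr ?(ltW Delta_gt0)//.
  by rewrite le_eqVlt; apply/orP; left; apply/eqP; field.
- by rewrite exprn_gt0// ltr_pwDl// !mulr_ge0 ?sqrtr_ge0// ltW.
- by rewrite ltr_pwDl// mulr_ge0// mulr_ge0 ?(ltW eta_gt0) ?(ltW M_gt0).
Qed.

Lemma bfgs_step : sym_posdef Bp /\ exists a : R,
  [/\ 0 < a, f xp - f xstar <= (1 - a) * Delta &
      Psi (L^-1 *: Bp) - Psi (L^-1 *: B) - ln mk <= ln (L / mu * a)].
Proof.
have [t [t_gt0 xpE dec curv]] := step_props.
have sE : xp - x = t *: d by rewrite xpE addrC addKr.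
have mk_gt0 : 0 < mk.
  rewrite lt_min divr_gt0//= exprn_gt0// ltr_pwDl//.
  by rewrite !mulr_ge0 ?sqrtr_ge0// ltW.
set y := grad f xp - grad f x in curv *.
set D := dotv y d in curv.
have D_gt0 : 0 < D by apply: lt_le_trans curv; rewrite divr_gt0.
have ysE : dotv y (xp - x) = t * D by rewrite sE dotvZr.
have ys_gt0 : 0 < dotv y (xp - x) by rewrite ysE mulr_gt0.
have [Bp_pd _ _] := bfgs_update_posdef B_pd ys_gt0.
split; first by [].
set G := dotv (grad f x) (grad f x).
have G_gt0 : 0 < G by exact: dotvv_gt0.
(* Since t e = -g.s, this is mu (-g.s) / |g|^2; gradient dominance turns the decrease -g.s / 2 into
   this fraction of [Delta]. *)
exists (mu * t * e / G); split; first by rewrite divr_gt0// !mulr_gt0.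
  have := grad_dominated mu_gt0 f_diff f_sc xstar x; rewrite -/G -/Delta => pl.
  have : mu * t * e / G * Delta <= t * e / 2.
    rewrite mulrAC ler_pdivrMr//.
    have -> : mu * t * e * Delta = t * e / 2 * (2 * mu * Delta) by field.
    by rewrite ler_pM2l// divr_gt0// mulr_gt0.
  move: dec; rewrite mulrBl mul1r /Delta -[e * t]mulrC.
  set P := _ * (f x - _); lra.
have Binv : 0 < L^-1 by rewrite invr_gt0.
rewrite Psi_bfgs_update// -/y.
have BsE : B *m (xp - x) = - t *: grad f x.
  by rewrite sE -scalemxAr Bd scalerN scaleNr.
have sBsE : dotv (xp - x) (B *m (xp - x)) = t ^+ 2 * e.
  by rewrite BsE sE dotvZl dotvZr (dotvC d) /e; ring.
have BsBsE : dotv (B *m (xp - x)) (B *m (xp - x)) = t ^+ 2 * G.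
  by rewrite BsE dotvZl dotvZr -/G; ring.
(* Cocoercivity caps the trace gained in the scaled update by 1. *)
have coc : L^-1 * (dotv y y / dotv y (xp - x)) <= 1.
  rewrite mulrA ler_pdivrMr// mul1r ler_pdivrMl//.
  exact: (grad_cocoercive mu_gt0 L_gt0 f_diff f_sc f_lip).
rewrite sBsE BsBsE ysE.
have -> : t * D / (t ^+ 2 * e) = D / e / t by field; rewrite !gt_eqF.
have -> : t ^+ 2 * G / (t ^+ 2 * e) = G / e by field; rewrite !gt_eqF.
have -> : L / mu * (mu * t * e / G) = t / (L^-1 * (G / e)).
  by field; rewrite !gt_eqF.
(* [u] is the trace lost in the scaled update, and kappa a = t / u. The 1 - u left in the change of
   [Psi] is absorbed by ln u <= u - 1. *)
set u := L^-1 * (G / e).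
have u_gt0 : 0 < u by rewrite mulr_gt0// divr_gt0.
rewrite [ln (_ / t)]ln_div ?posrE ?divr_gt0// [ln (t / u)]ln_div ?posrE//.
have lnu : ln u <= u - 1.
  have := @le_ln1Dx _ (u - 1); rewrite addrCA subrr addr0; apply; lra.
have lnD : - ln mk <= ln (D / e).
  rewrite -lnV ?posrE// ler_ln ?posrE ?invr_gt0 ?divr_gt0//.
  by rewrite ler_pdivlMr// mulrC.
by move: coc; rewrite ysE; lra.
Qed.

End OneStep.

(** * From one iteration to the global rate *)

Lemma AGM_ord (R : realType) (k : nat) (a : nat -> R) :
  (forall i, (i < k)%N -> 0 <= a i) ->
  \prod_(i < k) a i <= ((\sum_(i < k) a i) / k%:R) ^+ k.
Proof.
move=> a0; have := @leif_AGM R 'I_k predT (fun i => a i) _.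
by rewrite card_ord => /(_ (fun i _ => a0 i (ltn_ord i)))[].
Qed.

(** AM-GM twice: the arithmetic mean of the [a i] is at least their geometric mean, hence at least
    [c]; the geometric mean of the 1 - a i is then at most 1 - c. *)
Lemma prod_onem_le (R : realType) (k : nat) (a : nat -> R) (c : R) :
  (0 < k)%N -> (forall i, (i < k)%N -> 0 <= a i <= 1) -> 0 <= c ->
  c ^+ k <= \prod_(i < k) a i ->
  \prod_(i < k) (1 - a i) <= (1 - c) ^+ k.
Proof.
move=> k0 a01 c0 ca; have kR : 0 < k%:R :> R by rewrite ltr0n.
have am := le_trans ca (AGM_ord (fun i ik => (andP (a01 i ik)).1)).
apply: le_trans (@AGM_ord _ k (fun i => 1 - a i) _) _ => [i ik|].
  by rewrite subr_ge0; case/andP: (a01 i ik).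
have S0 : 0 <= \sum_(i < k) a i.
  by apply: sumr_ge0 => i _; case/andP: (a01 i (ltn_ord i)).
have {am} cS : c <= (\sum_(i < k) a i) / k%:R.
  by rewrite -(ler_pXn2r k0)// ?nnegrE// divr_ge0// ltW.
have SE : \sum_(i < k) (1 - a i) = k%:R - \sum_(i < k) a i.
  by rewrite sumrB sumr_const card_ord.
have S1 : \sum_(i < k) a i <= k%:R.
  rewrite -subr_ge0 -SE; apply: sumr_ge0 => i _.
  by rewrite subr_ge0; case/andP: (a01 i (ltn_ord i)).
rewrite SE mulrBl divff ?gt_eqF// lerXn2r ?nnegrE ?lerB//.
- by rewrite subr_ge0 ler_pdivrMr// mul1r.
- by rewrite subr_ge0 (le_trans cS)// ler_pdivrMr// mul1r.
Qed.

(** A rational bound from exp(-1/8) >= 7/8 and (7/8)^4 >= 4/7; it fixes the constant of the linear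
    phase. *)
Lemma expRN_half (R : realType) : 4 / 7 <= expR (- (1 / 2)) :> R.
Proof.
have -> : - (1 / 2) = - (1 / 8) * 4 :> R by field.
rewrite expRM_natr; have := @expR_ge1Dx R (- (1 / 8)) => h.
have : (7 / 8) ^+ 4 <= expR (- (1 / 8)) ^+ 4 :> R.
  by rewrite lerXn2r ?nnegrE ?expR_ge0//; lra.
by apply: le_trans; lra.
Qed.

(* [4 ln(1+u)^2] has the growth of [int_0^u 8 ln(1+s)/s ds]; the bounded
   second term compensates its slope near 0. *)
Definition tail_potential (R : realType) (u : R) : R :=
  4 * ln (1 + u) ^+ 2 + 24 * (1 - (1 + u)^-1).

Lemma is_derive_ln1D (R : realType) (u : R) : 0 < 1 + u ->
  is_derive u (1 : R) (fun s : R => ln (1 + s)) (1 + u)^-1.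
Proof.
move=> u1.
have h : is_derive u (1 : R) (cst 1 + @id R) (0 + 1) by exact: is_deriveD.
have h1 :=
  @is_derive1_comp R (@ln R) (cst 1 + @id R) u _ _ (is_derive1_ln u1) h.
by apply: is_derive_eq h1 _; rewrite add0r mulr1.
Qed.

Lemma tail_potential_drop (R : realType) (a b : R) : 0 < b -> b <= a ->
  7 * ln (1 + b) * (ln a - ln b) <= tail_potential a - tail_potential b.
Proof.
move=> b0 ba.
pose H' (u : R) : R := 7 * ln (1 + b) * u^-1.
pose F' (u : R) : R := 8 * ln (1 + u) / (1 + u) + 24 / (1 + u) ^+ 2.
have dH (u : R) : b <= u <= a ->
    is_derive u (1 : R) (fun s : R => 7 * ln (1 + b) * ln s) (H' u).
  move=> /andP[bu _]; have u0 : 0 < u by exact: lt_le_trans bu.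
  exact: is_deriveZ (is_derive1_ln u0).
have dF (u : R) : b <= u <= a -> is_derive u (1 : R) (@tail_potential R) (F' u).
  move=> /andP[bu _]; have u0 : 0 < u by exact: lt_le_trans bu.
  have u1 : 0 < 1 + u by rewrite ltr_pwDl// ltW.
  have d1 := is_derive_ln1D u1.
  have u1' : 1 + 1 * u != 0 by rewrite mul1r gt_eqF.
  have d2 := is_derive_inv_affine u1'.
  have h : is_derive u (1 : R) (4 *: ((fun s : R => ln (1 + s)) ^+ 2) +
     24 *: (cst 1 - (fun s : R => (1 + 1 * s)^-1)))
     (_ *: (_ *: _) + _ *: (_ - _)) :=
    is_deriveD (is_deriveZ 4 (is_deriveX 2 d1))
      (is_deriveZ 24 (is_deriveB (is_derive_cst _ _ _) d2)).
  have -> : @tail_potential R = 4 *: ((fun s : R => ln (1 + s)) ^+ 2) +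
     24 *: (cst 1 - (fun s : R => (1 + 1 * s)^-1)).
    apply/funext => s; rewrite /tail_potential -{2}[s]mul1r.
    by [].
  apply: is_derive_eq h _; rewrite /GRing.scale/= /F' mul1r expr1; field.
  by rewrite gt_eqF.
have := ler_increment ba dH dF.
move=> h; rewrite mulrBr; apply: h => u /andP[bu _].
have u0 : 0 < u by exact: lt_le_trans bu.
have u1 : 0 < 1 + u by rewrite ltr_pwDl// ltW.
have l0 : 0 <= ln (1 + u) by rewrite ln_ge0// lerDl ltW.
have lu : ln (1 + u) <= u by rewrite le_ln1Dx// (lt_trans (ltrN10 _)).
(* Freezing the logarithm at [b] only lowers the integrand, so it is enough that the derivative of
   the potential dominates 7 ln(1 + u) / u. *)
apply: le_trans (_ : 7 * ln (1 + u) * u^-1 <= _).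
  rewrite /H' ler_pM2r ?invr_gt0// ler_pM2l// ler_ln ?posrE ?lerD2l//.
  by rewrite ltr_pwDl// ltW.
rewrite -subr_ge0.
set l := ln _ in l0 lu *.
have -> : F' u - 7 * l / u =
    (l * (1 + u) * (u - 7) + 24 * u) / (u * (1 + u) ^+ 2).
  by rewrite /F' -/l; field; rewrite !gt_eqF.
apply: divr_ge0; last by rewrite mulr_ge0 ?sqr_ge0 ?ltW.
(* For u < 7, ln(1 + u) <= u reduces the claim to u ((u - 3)^2 + 8) >= 0, which the constant 24
   makes possible. *)
have [u7|u7] := leP 7 u.
  by rewrite addr_ge0// ?mulr_ge0 ?subr_ge0// ltW.
have : 0 <= (u - l) * ((1 + u) * (7 - u)).
  by rewrite mulr_ge0 ?subr_ge0// mulr_ge0 ?subr_ge0// ltW.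
have : 0 <= u * ((u - 3) ^+ 2 + 8).
  by rewrite mulr_ge0 ?(ltW u0)// addr_ge0 ?sqr_ge0.
by lra.
Qed.

Lemma tail_potential_ge0 (R : realType) (u : R) : 0 <= u ->
  0 <= tail_potential u.
Proof.
move=> u0; rewrite addr_ge0// mulr_ge0 ?sqr_ge0// subr_ge0 invf_le1 ?lerDl//.
by rewrite ltr_pwDl.
Qed.

Lemma tail_potential_le (R : realType) (u : R) : 0 <= u ->
  tail_potential u <= ln ((1 + u) ^+ 2) ^+ 2 + 24.
Proof.
move=> u0; have u1 : 0 < 1 + u by rewrite ltr_pwDl.
have : 0 < (1 + u)^-1 by rewrite invr_gt0.
by rewrite /tail_potential lnXn// -mulr_natr; set i := _^-1; set l := ln _; nra.
Qed.

Lemma count_lt_le (R : realType) (c : R) (k : nat) : 0 <= c ->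
  \sum_(j < k) ((j%:R < c)%R)%:R <= c + 1 :> R.
Proof.
(* The trivial bound by [k] is carried through the induction: it settles the case where the last
   index is below [c]. *)
move=> c0; have : \sum_(j < k) ((j%:R < c)%R)%:R <= k%:R :> R.
  rewrite -[k in leRHS]card_ord -sumr_const; apply: ler_sum => j _.
  by case: (_ < _).
elim: k => [|k IH]; first by rewrite big_ord0 addr_ge0.
rewrite big_ord_recr/=; case: ltP => [kc|ck].
  by move=> h; apply: (le_trans h); rewrite -natr1 lerD2r ltW.
rewrite addr0 => _; apply: IH.
rewrite -[k in leRHS]card_ord -sumr_const; apply: ler_sum => j _.
by case: (_ < _).
Qed.

(** * From an abstract scalar recursion to the rate *)

Section Rate.
Context {R : realType}.
Variables (kappa c : R) (Delta P a : nat -> R).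
Hypothesis kappa_ge1 : 1 <= kappa.
Hypothesis c_gt0 : 0 < c.
Hypothesis Delta_gt0 : forall k, 0 < Delta k.
Hypothesis P_ge0 : forall k, 0 <= P k.
Hypothesis a_gt0 : forall k, 0 < a k.
Hypothesis Delta_step : forall k, Delta k.+1 <= (1 - a k) * Delta k.
Let gam k : R := Num.min kappa ((1 + c * Num.sqrt (Delta k)) ^+ 2).
Hypothesis P_step : forall k, P k.+1 - P k - ln (gam k) <= ln (kappa * a k).
Let m := gam 0.
Let W := c * Num.sqrt (Delta 0).

Let kappa_gt0 : 0 < kappa. Proof. exact: lt_le_trans kappa_ge1. Qed.

Let a_le1 k : a k <= 1.
Proof.
have := lt_le_trans (Delta_gt0 k.+1) (Delta_step k).
by rewrite pmulr_lgt0// subr_gt0 => /ltW.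
Qed.

Let Delta_prod k : Delta k <= \prod_(j < k) (1 - a j) * Delta 0.
Proof.
elim: k => [|k IH]; first by rewrite big_ord0 mul1r.
apply: (le_trans (Delta_step k)); rewrite big_ord_recr/= mulrAC mulrC.
by rewrite ler_wpM2r// subr_ge0.
Qed.

Let Delta_le0 k : Delta k <= Delta 0.
Proof.
elim: k => // k IH; apply: le_trans (Delta_step k) (le_trans _ IH).
by rewrite -[leRHS]mul1r ler_pM2r// gerBl ltW.
Qed.

Let gam_ge1 k : 1 <= gam k.
Proof.
by rewrite /gam le_min kappa_ge1 exprn_ege1// lerDl mulr_ge0 ?sqrtr_ge0// ltW.
Qed.

Let gam_gt0 k : 0 < gam k. Proof. exact: lt_le_trans (gam_ge1 k). Qed.
Let m_gt0 : 0 < m. Proof. exact: gam_gt0. Qed.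
Let ln_gam_ge0 k : 0 <= ln (gam k). Proof. exact: ln_ge0. Qed.

Let gam_le k : ln (gam k) <= ln m.
Proof.
rewrite /m ler_ln ?posrE// /gam le_min ge_min lexx/= ge_min; apply/orP; right.
rewrite lerXn2r ?nnegrE ?addr_ge0 ?mulr_ge0 ?sqrtr_ge0 ?(ltW c_gt0)//.
by rewrite lerD2l ler_pM2l// ler_wsqrtr.
Qed.

(** Telescoping [P_step] with P k >= 0 bounds the sum of the ln (kappa a_j) below by -(P 0 + S),
    that is, the geometric mean of the a_j. *)
Lemma rate_of_sum_ln k S : (0 < k)%N -> \sum_(j < k) ln (gam j) <= S ->
  Delta k <= (1 - kappa^-1 * expR (- ((P 0 + S) / k%:R))) ^+ k * Delta 0.
Proof.
move=> k0 sumS.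
apply: (le_trans (Delta_prod k)); rewrite ler_pM2r//.
apply: prod_onem_le => // [i _||].
- by rewrite (ltW (a_gt0 i)) a_le1.
- by rewrite mulr_ge0 ?expR_ge0// invr_ge0 ltW.
have kaE j : kappa * a j = expR (ln (kappa * a j)).
  by rewrite lnK// posrE mulr_gt0.
have prodE : kappa ^+ k * \prod_(i < k) a i =
    expR (\sum_(i < k) ln (kappa * a i)).
  rewrite expR_sum -[k in kappa ^+ k]card_ord -prodr_const -big_split/=.
  by apply: eq_bigr => i _; exact: kaE.
rewrite exprMn exprVn ler_pdivrMl ?exprn_gt0// prodE -expRM_natr ler_expR.
rewrite mulNr divfK ?pnatr_eq0 -?lt0n//.
have tel : P k - P 0 - \sum_(j < k) ln (gam j) <= \sum_(i < k) ln (kappa * a i).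
  elim: (k) => [|k' IH]; first by rewrite !big_ord0; lra.
  by rewrite !big_ord_recr/=; have := P_step k'; lra.
by have := P_ge0 k; lra.
Qed.

(** [q] contracts the gap in the linear phase; [gam] sees the square root of the gap, which
    contracts by [s]. *)
Let q := 1 - 4 / 7 / (kappa * m).
Let s := Num.sqrt q.

Let km_ge1 : 1 <= kappa * m. Proof. exact: mulr_ege1 kappa_ge1 (gam_ge1 0). Qed.
Let km_gt0 : 0 < kappa * m. Proof. exact: lt_le_trans km_ge1. Qed.

Let drop_gt0 : 0 < 4 / 7 / (kappa * m).
Proof. by rewrite divr_gt0//; lra. Qed.

Let q_gt0 : 0 < q.
Proof.
have h := km_ge1; rewrite subr_gt0 ltr_pdivrMr//; lra.
Qed.

Let s_gt0 : 0 < s. Proof. by rewrite sqrtr_gt0. Qed.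
Let s_le1 : s <= 1.
Proof. by rewrite -sqrtr1 ler_wsqrtr// gerBl ltW. Qed.
Let W_gt0 : 0 < W. Proof. by rewrite mulr_gt0// sqrtr_gt0. Qed.

(** Bounding every [gam j] by [m] leaves the exponent P 0 / k + ln m with P 0 / k <= 1/2. The added
    1 also ensures k > 0. *)
Let linear_phase k : 2 * P 0 + 1 <= k%:R -> Delta k <= q ^+ k * Delta 0.
Proof.
move=> hk; have P0 := P_ge0 0.
have k0 : (0 < k)%N by rewrite -(@ltr0n R); lra.
have kR : 0 < k%:R :> R by rewrite ltr0n.
have sumS : \sum_(j < k) ln (gam j) <= k%:R * ln m.
  apply: (@le_trans _ _ (\sum_(j < k) ln m)).
    by apply: ler_sum => j _; exact: gam_le.
  by rewrite sumr_const card_ord mulr_natl.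
apply: (le_trans (rate_of_sum_ln k0 sumS)); rewrite ler_pM2r//.
have e1 : - ((P 0 + k%:R * ln m) / k%:R) = - (P 0 / k%:R) - ln m.
  by field; rewrite gt_eqF.
have le : 4 / 7 / (kappa * m) <=
    kappa^-1 * expR (- ((P 0 + k%:R * ln m) / k%:R)).
  rewrite e1 expRB lnK ?posrE// invfM mulrCA ler_pM2l ?invr_gt0//.
  rewrite ler_pM2r ?invr_gt0//; apply: le_trans (expRN_half R) _.
  by rewrite ler_expR lerN2 ler_pdivrMr//; lra.
rewrite lerXn2r ?nnegrE ?lerB// ?(ltW q_gt0)// subr_ge0.
rewrite mulrC ler_pdivrMr// mul1r; apply: le_trans kappa_ge1.
rewrite -expR0 ler_expR oppr_le0 divr_ge0 ?(ltW kR)// addr_ge0//.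
by rewrite mulr_ge0 ?(ltW kR)// ln_gam_ge0.
Qed.

(** The potential drop along the geometric sequence W s^j; the truncated predecessor makes T 0 =
    0. *)
Let T (j : nat) : R :=
  tail_potential (W * s ^+ j.-1) - tail_potential (W * s ^+ j).

Let Ws_gt0 j : 0 < W * s ^+ j. Proof. by rewrite mulr_gt0// exprn_gt0. Qed.

(** Consecutive points differ by -ln s >= (2/7) / (kappa m) in logarithm, and the factor 7 of the
    drop lemma turns 2/7 into 2. *)
Let T_ge j : 2 * ln (1 + W * s ^+ j.+1) <= kappa * m * T j.+1.
Proof.
have l0 : 0 <= ln (1 + W * s ^+ j.+1) by rewrite ln_ge0// lerDl ltW.
have sE : W * s ^+ j.+1 = W * s ^+ j * s by rewrite exprSr mulrA.
have le : W * s ^+ j.+1 <= W * s ^+ j by rewrite sE ger_pMr.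
have := tail_potential_drop (Ws_gt0 j.+1) le.
rewrite -ler_pdivrMl// -/(T j.+1); apply: le_trans.
set l := ln (1 + _) in l0 *.
rewrite sE [ln (_ * s)]lnM ?posrE//.
have lnq : ln q <= - (4 / 7 / (kappa * m)).
  by apply: le_ln1Dx; rewrite ltrNl opprK -subr_gt0.
have lns : ln q = 2 * ln s.
  by rewrite -(sqr_sqrtr (ltW q_gt0)) -/s lnXn// mulr_natl.
have h : 2 / 7 / (kappa * m) <= - ln s.
  move: lnq; rewrite lns.
  have -> : 4 / 7 / (kappa * m) = 2 * (2 / 7 / (kappa * m)).
    by set i := (kappa * m)^-1; lra.
  by set u := 2 / 7 / _; lra.
have -> : ln (W * s ^+ j) - (ln (W * s ^+ j) + ln s) = - ln s by lra.
apply: le_trans (_ : 7 * l * (2 / 7 / (kappa * m)) <= _).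
  by set i := (kappa * m)^-1; lra.
by rewrite ler_wpM2l// mulr_ge0.
Qed.

Let T_ge0 j : 0 <= kappa * m * T j.
Proof.
case: j => [|j]; first by rewrite /T subrr mulr0.
by apply: le_trans (T_ge j); rewrite mulr_ge0// ln_ge0// lerDl ltW.
Qed.

Let ln_gam_tail j : 2 * P 0 + 1 <= j.+1%:R ->
  ln (gam j.+1) <= kappa * m * T j.+1.
Proof.
move=> hj; apply: le_trans (T_ge j).
rewrite mulr_natl -lnXn ?posrE; last by rewrite ltr_pwDl// ltW.
rewrite ler_ln ?posrE ?exprn_gt0//; last by rewrite ltr_pwDl// ltW.
rewrite /gam ge_min; apply/orP; right.
rewrite lerXn2r ?nnegrE ?addr_ge0 ?(ltW (Ws_gt0 _)) ?mulr_ge0 ?sqrtr_ge0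
  ?(ltW c_gt0)//.
rewrite lerD2l /W -mulrA ler_pM2l//.
have -> : Num.sqrt (Delta 0) * s ^+ j.+1 = Num.sqrt (q ^+ j.+1 * Delta 0).
  rewrite mulrC sqrtrM ?exprn_ge0 ?(ltW q_gt0)//; congr (_ * _).
  rewrite -[LHS]gtr0_norm ?exprn_gt0// -sqrtr_sqr; congr Num.sqrt.
  by rewrite exprAC sqr_sqrtr// ltW.
by rewrite ler_wsqrtr// linear_phase.
Qed.

Lemma sum_ln_gam k : \sum_(j < k) ln (gam j) <=
  2 * (P 0 + 1) * ln m + kappa * m * (ln ((1 + W) ^+ 2) ^+ 2 + 24).
Proof.
have P0 := P_ge0 0; have lm0 := ln_gam_ge0 0.
(* Early indices, at most 2 P 0 + 2 of them, cost ln m each; later ones are paid by [T], whose sum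
   telescopes independently of [k]. *)
have each j : ln (gam j) <=
    ((j%:R < 2 * P 0 + 1)%R)%:R * ln m + kappa * m * T j.
  have [hj|hj] := ltP; first by rewrite mul1r ler_wpDr.
  rewrite mul0r add0r; case: j hj => [|j] hj; first by exfalso; lra.
  exact: ln_gam_tail.
apply: (@le_trans _ _ (\sum_(j < k)
    (((j%:R < 2 * P 0 + 1)%R)%:R * ln m + kappa * m * T j))).
  by apply: ler_sum => j _; exact: each.
rewrite big_split/= -mulr_suml -mulr_sumr lerD//.
  rewrite ler_wpM2r//; apply: le_trans (count_lt_le _ _) _; lra.
rewrite ler_pM2l//.
apply: le_trans (tail_potential_le (ltW W_gt0)).
have tel k' : \sum_(j < k') T j =
    tail_potential W - tail_potential (W * s ^+ k'.-1).
  elim: k' => [|[|k'] IH]; first by rewrite big_ord0 expr0 mulr1 subrr.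
    by rewrite big_ord_recr IH/= /T !expr0 mulr1 !subrr addr0.
  by rewrite big_ord_recr IH/= /T/= addrA subrK.
by rewrite tel gerBl tail_potential_ge0// ltW.
Qed.

Lemma rate_of_recursion (Gamma := (1 + W) ^+ 2)
    (K := (P 0 + 1) * (2 * ln m + 1) + kappa * m * (ln Gamma ^+ 2 + 24)) :
  (forall k, (0 < k)%N ->
    Delta k / Delta 0 <= (1 - kappa^-1 * expR (- (K / k%:R))) ^+ k) /\
  (forall k, 2 * K <= k%:R -> Delta k / Delta 0 <= (1 - (2 * kappa)^-1) ^+ k).
Proof.
have P0 := P_ge0 0; have lm0 := ln_gam_ge0 0.
have kml : 0 < kappa * m * (ln Gamma ^+ 2 + 24).
  by rewrite mulr_gt0// ltr_wpDl// sqr_ge0.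
have K_gt0 : 0 < K.
  by rewrite ltr_wpDl// mulr_ge0 ?addr_ge0// mulr_ge0.
have base_ge0 (u : R) : 0 <= u -> 0 <= 1 - kappa^-1 * expR (- u).
  move=> u0; rewrite subr_ge0 mulrC ler_pdivrMr// mul1r.
  by apply: le_trans kappa_ge1; rewrite -expR0 ler_expR oppr_le0.
have first k : (0 < k)%N ->
    Delta k / Delta 0 <= (1 - kappa^-1 * expR (- (K / k%:R))) ^+ k.
  move=> k0; have kR : 0 < k%:R :> R by rewrite ltr0n.
  rewrite ler_pdivrMr//; apply: (le_trans (rate_of_sum_ln k0 (sum_ln_gam k))).
  set S := _ + _ * (_ + 24).
  have S0 : 0 <= S.
    by rewrite addr_ge0 ?(ltW kml)// mulr_ge0// mulr_ge0// addr_ge0.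
  have SK : P 0 + S <= K.
    by rewrite /K /S -/Gamma; set u := kappa * m * _; lra.
  move: S S0 SK => S S0 SK.
  have b1 := base_ge0 _ (divr_ge0 (addr_ge0 P0 S0) (ltW kR)).
  have b2 := base_ge0 _ (divr_ge0 (ltW K_gt0) (ltW kR)).
  rewrite ler_pM2r// lerXn2r ?nnegrE//.
  rewrite lerB// ler_pM2l ?invr_gt0// ler_expR lerN2.
  by rewrite ler_pM2r ?invr_gt0.
split=> // k hk.
have kR : 0 < k%:R :> R by apply: lt_le_trans hk; rewrite mulr_gt0.
have k0 : (0 < k)%N by rewrite -(@ltr0n R).
apply: (le_trans (first k k0)).
have b := base_ge0 _ (divr_ge0 (ltW K_gt0) (ltW kR)).
rewrite lerXn2r ?nnegrE//.
  by have k1 := kappa_ge1; rewrite subr_ge0 invf_le1; lra.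
rewrite lerB// invfM mulrC ler_pM2l ?invr_gt0//.
(* For k >= 2 K the exponent is at least -1/2, so exp(-K / k) >= 1 - K / k >= 1/2. *)
have := @expR_ge1Dx R (- (K / k%:R)).
have : K / k%:R <= 2^-1 by rewrite ler_pdivrMr//; lra.
by set u := K / _; lra.
Qed.

End Rate.

(** * The recursion applied to the BFGS iterates *)

Theorem theorem4 (R : realType) (n : nat) (mu L M : R)
    (mu_gt0 : 0 < mu) (L_gt0 : 0 < L) (M_gt0 : 0 < M)
    (f : 'cV[R]_n -> R)
    (f_C3 : cont_diff 3 f)
    (f_sc : strongly_convex mu f)
    (f_lip : lipschitz_grad L f)
    (f_conc : self_concordant M f)
    (xstar : 'cV[R]_n) (xstar_min : is_minimizer f xstar)
    (x0 : 'cV[R]_n) (B0 : 'M[R]_n) (B0_pd : sym_posdef B0)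
    (x : nat -> 'cV[R]_n) (B : nat -> 'M[R]_n)
    (xB_bfgs : adaptive_bfgs M L f x0 B0 x B)
    (grad_neq0 : forall k : nat, grad f (x k) != 0) :
  let kappa := L / mu in
  let Delta := f x0 - f xstar in
  let B0bar := L^-1 *: B0 in
  let Gamma := (1 + Num.sqrt 2 * M * Num.sqrt Delta) ^+ 2 in
  let m := Num.min Gamma kappa in
  let K := (Psi B0bar + 1) * (2 * ln m + 1)
           + kappa * m * (ln Gamma ^+ 2 + 24) in
  (forall k : nat, (1 <= k)%N ->
     (f (x k) - f xstar) / (f x0 - f xstar)
       <= (1 - kappa^-1 * expR (- (K / k%:R))) ^+ k) /\
  (forall k : nat,
     2 * (Psi B0bar + 1) * (2 * ln m + 1)
       + 2 * kappa * m * (ln Gamma ^+ 2 + 24) <= k%:R ->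
     (f (x k) - f xstar) / (f x0 - f xstar)
       <= (1 - (2 * kappa)^-1) ^+ k).
Proof.
move=> kappa Delta B0bar Gamma m K.
have [x0E B0E step] := xB_bfgs; have f_diff := f_C3.1.
have stepE k : x k.+1 = x k + adaptive_step M L f (x k)
      (bfgs_direction f (x k) (B k)) *: bfgs_direction f (x k) (B k) /\
    B k.+1 = bfgs_update (B k) (x k.+1 - x k)
      (grad f (x k.+1) - grad f (x k)) by exact: step.
have B_pd k : sym_posdef (B k).
  elim: k => [|k IH]; first by rewrite B0E.
  have [xE BE] := stepE k; rewrite BE xE.
  by have [] := bfgs_step mu_gt0 L_gt0 M_gt0 f_C3 f_sc f_lip f_conc xstar_min
    IH (grad_neq0 k).
pose gap k := f (x k) - f xstar.
have gap_gt0 k : 0 < gap k.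
  by rewrite subr_gt0; exact: (not_minimizer_gt L_gt0 f_diff f_lip).
have kappa_ge1 : 1 <= kappa.
  have N_gt0 := dotvv_gt0 (grad_neq0 0).
  (* The lower and upper slope bounds along the nonzero gradient at the starting point give mu <=
     L. *)
  have lo := derive_line_mono f_C3 f_sc (x 0) (grad f (x 0)) (@ler01 R).
  have hi := derive_line_lip f_C3 f_lip (x 0) (grad f (x 0)) (@ler01 R).
  have := le_trans lo hi; rewrite subr0 !mulr1 ler_pM2r// => muL.
  by rewrite ler_pdivlMr// mul1r.
pose P k := Psi (L^-1 *: B k).
have P_ge0 k : 0 <= P k.
  by apply: (sym_posdef_Psi (sym_posdefZ _ (B_pd k))).2; rewrite invr_gt0.
have stepP k : exists a : R, [/\ 0 < a, gap k.+1 <= (1 - a) * gap k &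
    P k.+1 - P k - ln (Num.min kappa
      ((1 + Num.sqrt 2 * M * Num.sqrt (gap k)) ^+ 2)) <= ln (kappa * a)].
  have [xE BE] := stepE k; rewrite /gap /P BE xE.
  by have [] := bfgs_step mu_gt0 L_gt0 M_gt0 f_C3 f_sc f_lip f_conc xstar_min
    (B_pd k) (grad_neq0 k).
have [a aP] := boolp.choice stepP.
have a_gt0 k : 0 < a k by case: (aP k).
have gap_step k : gap k.+1 <= (1 - a k) * gap k by case: (aP k).
have P_step k : P k.+1 - P k - ln (Num.min kappa
    ((1 + Num.sqrt 2 * M * Num.sqrt (gap k)) ^+ 2)) <= ln (kappa * a k).
  by case: (aP k).
have c_gt0 : 0 < Num.sqrt 2 * M by rewrite mulr_gt0// sqrtr_gt0.
have [h1 h2] :=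
  rate_of_recursion kappa_ge1 c_gt0 gap_gt0 P_ge0 a_gt0 gap_step P_step.
have gap0 : gap 0%N = Delta by rewrite /gap x0E.
have P0 : P 0%N = Psi B0bar by rewrite /P B0E.
move: h1 h2; rewrite gap0 P0 minC -/Gamma -/m -/K => h1 h2.
split=> k hk; first exact: h1.
apply: h2; apply: le_trans hk; rewrite le_eqVlt; apply/orP; left; apply/eqP.
by rewrite /K; ring.
Qed.
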